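(* Let $0 \le k < d$ be integers and let $\varepsilon, \eta, \kappa, \alpha, c_0 > 0$ be real numbers. Then there exists a constant $C$, depending only on $d,k,\varepsilon,\eta,\kappa,\alpha,c_0$, such that the following holds for every positive integer $N$. Set $Q = N^{\varepsilon/(2d)}$, let $P \subseteq \mathcal{P}(Q)$ satisfy $w(P) \ge \kappa \log Q$, and let $S \subseteq [N]^d$ be a set with $|S| \ge c_0 N^{k-1+\varepsilon}$ occupying at most $\alpha p^k$ residue classes modulo $p$ for every prime $p \in P$. Then there exists a polynomial $f \in \mathbb{Z}[x_1,\ldots,x_d]$ of degree at most $C$, with all coefficients bounded in absolute value by $N^C$, which vanishes at more than $(1-\eta)|S|$ points of $S$.
   Context: $[N] = \{0,1,\ldots,N\}$. $\mathcal{P}(Q)$ denotes the set of primes $p \le Q$, and for a finite set of primes $P$, $w(P) := \sum_{p \in P} \frac{\log p}{p}$. A set $S \subseteq \mathbb{Z}^d$ occupies $m$ residue classes mod $p$ if its image in $(\mathbb{Z}/p\mathbb{Z})^d$ has $m$ elements. *)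

(* Defs.v *)
From Stdlib Require Import Reals.
From HB Require Import structures.
From mathcomp Require Import all_boot all_order all_algebra.
From mathcomp Require Import mpoly.
Set Implicit Arguments. Unset Strict Implicit. Unset Printing Implicit Defensive.

(* A point of [N]^d = {0,...,N}^d *)
Definition point (d N : nat) := {ffun 'I_d -> 'I_N.+1}.

Definition redp (d N p : nat) (x : point d N) : {ffun 'I_d -> nat} :=
  [ffun i => (x i : nat) %% p].

Definition nclasses (d N p : nat) (S : {set point d N}) : nat :=
  size (undup [seq redp p x | x <- enum S]).

(* w(P) = sum_{p in P} log p / p, for P given as a duplicate-free list of primes *)
Definition wP (P : seq nat) : R :=
  foldr (fun p acc => Rplus (Rdiv (ln (INR p)) (INR p)) acc) R0 P.

Definition evalpt (d N : nat) (f : {mpoly int[d]}) (x : point d N) : int :=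
  (f.@[fun i => Posz (x i : nat)])%R.

(* Main.v *)
(* The proof is an induction on k, fibring S over a coordinate, and it produces
   a set A of O(r^k) points such that every integer polynomial of size at most N^r
   on the box that vanishes on A vanishes on most of S.
   By the larger sieve, outside a negligible part of S some coordinate x_i is
   spread well enough that the fibres x_i = a satisfy the hypotheses with k-1 in
   place of k, and thus have test sets of size O(r^(k-1)).  A greedy choice of O(r)
   fibres makes most x in S agree, modulo many primes p, with a point of a chosen
   fibre where f vanishes; all these p divide f(x), and their product exceeds N^r,
   so f(x) = 0.  That the fibres hit enough classes follows from the larger sieve,
   iterated over the coordinates: a set of N^(k-1+eps) points occupies >> p^k
   classes for many p.
   Since k < d there are more monomials of degree O(r) than points of A, and
   Siegel's pigeonhole argument gives a nonzero f of controlled size vanishing on A. *)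
Require Import Defs.
From Stdlib Require Import Reals.
From HB Require Import structures.
From mathcomp Require Import all_boot all_order all_algebra.
From mathcomp Require Import mpoly.
From mathcomp Require Import zify.
From Stdlib Require Import Lra.

Set Implicit Arguments. Unset Strict Implicit. Unset Printing Implicit Defensive.
Local Open Scope R_scope.

(** The argument looks circular: the test set must suit the polynomial, whose size N^r depends on
    the number of points to be killed. The order of quantifiers breaks the circle. The constant [c]
    in [c * r ^ k] is fixed before r and only the threshold on N comes after it, so the degree can
    be chosen last, and k < d makes it win. The exponent eps/(2d) enters as follows. In each
    coordinate O(Q) values are exceptional, so the points all of whose coordinates are exceptional
    number O(Q^d) = O(N^(eps/2)), which is negligible in S once the dimension is at least 1. Hence
    almost every point has a coordinate along which fibring works. The obstacle is in the greedy
    choice: the primes still useful after some fibres are chosen differ from point to point. The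
    sieve statements therefore let each point x carry its own set [E x] of primes, of weight at
    least a constant times log N. *)

HB.instance Definition _ := Monoid.isComLaw.Build R 0 Rplus
  (fun x y z => esym (Rplus_assoc x y z)) Rplus_comm Rplus_0_l.
HB.instance Definition _ := Monoid.isMulLaw.Build R 0 Rmult Rmult_0_l Rmult_0_r.
HB.instance Definition _ :=
  Monoid.isAddLaw.Build R Rmult Rplus Rmult_plus_distr_r Rmult_plus_distr_l.

Notation "\rsum_ ( i <- r | P ) F" := (\big[Rplus/R0]_(i <- r | P%B) F)
  (at level 41, F at level 41, i, r at level 50).
Notation "\rsum_ ( i <- r ) F" := (\big[Rplus/R0]_(i <- r) F)
  (at level 41, F at level 41, i, r at level 50).
Notation "\rsum_ ( i 'in' A ) F" := (\big[Rplus/R0]_(i in A) F)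
  (at level 41, F at level 41, i, A at level 50).
Notation "\rsum_ ( i 'in' A | P ) F" := (\big[Rplus/R0]_(i in A | P%B) F)
  (at level 41, F at level 41, i, A at level 50).
Notation "\rsum_ ( i | P ) F" := (\big[Rplus/R0]_(i | P%B) F)
  (at level 41, F at level 41, i at level 50).

(** Boolean form of the real order, so that real inequalities can cut out finite sets and sets of
    primes. *)
Definition rle (x y : R) : bool := if Rle_dec x y then true else false.

Lemma rleP x y : reflect (x <= y) (rle x y).
Proof. by rewrite /rle; case: Rle_dec => h; constructor. Qed.

Lemma rleNP x y : reflect (y < x) (~~ rle x y).
Proof. by apply: (iffP negP) => [h|h /rleP]; [apply: Rnot_le_lt => /rleP|lra]. Qed.

(** * Finite sums of reals and cardinalities *)

Lemma rsum_ge0 (I : eqType) (r : seq I) (P : pred I) (F : I -> R) :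
  (forall i, i \in r -> P i -> 0 <= F i) -> 0 <= \rsum_(i <- r | P i) F i.
Proof.
move=> h; rewrite big_seq_cond; apply: (big_ind (fun x => 0 <= x)) => [|x y ? ?|i /andP[? ?]]; try lra.
exact: h.
Qed.

Lemma rsum_le (I : eqType) (r : seq I) (P : pred I) (F G : I -> R) :
  (forall i, i \in r -> P i -> F i <= G i) ->
  \rsum_(i <- r | P i) F i <= \rsum_(i <- r | P i) G i.
Proof.
move=> h; rewrite big_seq_cond [X in _ <= X]big_seq_cond.
apply: (big_ind2 (fun x y => x <= y)) => [|x y z t ? ?|i /andP[? ?]]; try lra.
exact: h.
Qed.

Lemma rsum_sub (I : eqType) (r : seq I) (P Q : pred I) (F : I -> R) :
  (forall i, i \in r -> 0 <= F i) -> (forall i, i \in r -> P i -> Q i) ->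
  \rsum_(i <- r | P i) F i <= \rsum_(i <- r | Q i) F i.
Proof.
move=> F0 PQ; rewrite big_mkcond [X in _ <= X]big_mkcond /=.
apply: rsum_le => i ir _; have := F0 _ ir; have := PQ _ ir.
by case: (P i); case: (Q i) => // h ?; try lra; have := h isT.
Qed.

Lemma rsumT_ge0 (I : finType) (P : pred I) (F : I -> R) :
  (forall i, P i -> 0 <= F i) -> 0 <= \rsum_(i | P i) F i.
Proof. by move=> h; apply: rsum_ge0 => i _; apply: h. Qed.

Lemma rsumT_le (I : finType) (P : pred I) (F G : I -> R) :
  (forall i, P i -> F i <= G i) -> \rsum_(i | P i) F i <= \rsum_(i | P i) G i.
Proof. by move=> h; apply: rsum_le => i _; apply: h. Qed.

Lemma rsum_const (I : finType) (A : {set I}) (c : R) : \rsum_(i in A) c = INR #|A| * c.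
Proof.
rewrite big_const; elim: #|A| => [|n IH]; first by rewrite /=; ring.
by rewrite iterS IH S_INR; ring.
Qed.

Lemma INR_card (I : finType) (A : {set I}) : INR #|A| = \rsum_(i in A) 1.
Proof. by rewrite rsum_const; ring. Qed.

Lemma rsum_indic (I : finType) (A : {set I}) (B : pred I) (c : R) :
  \rsum_(i in A) (if B i then c else 0) = INR #|[set i in A | B i]| * c.
Proof.
rewrite -rsum_const -big_mkcondr; apply: eq_bigl => i.
by rewrite inE.
Qed.

Lemma INR_cardm (I : finType) (A B : {set I}) : A \subset B -> INR #|A| <= INR #|B|.
Proof. by move=> h; apply: le_INR; apply/leP; apply: subset_leq_card. Qed.

Lemma leq_INR m n : (m <= n)%N -> INR m <= INR n.
Proof. by move=> h; apply: le_INR; apply/leP. Qed.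

Lemma INR_cardU (I : finType) (A B : {set I}) :
  INR #|A :|: B| <= INR #|A| + INR #|B|.
Proof. by rewrite -plus_INR; apply: leq_INR; rewrite plusE cardsU leq_subr. Qed.

Lemma INR_card_bigcup (I J : finType) (F : J -> {set I}) (c : R) :
  (forall j, INR #|F j| <= c) -> INR #|\bigcup_j F j| <= INR #|J| * c.
Proof.
move=> h; apply: (@Rle_trans _ (\rsum_(j in [set: J]) INR #|F j|)).
  rewrite [X in _ <= X](eq_bigl xpredT) => [|j]; last by rewrite inE.
  apply: (big_ind2 (fun (A : {set I}) r => INR #|A| <= r)) => [|A r B s ? ?|j _].
  - rewrite cards0 /=; lra.
  - have := INR_cardU A B; lra.
  - lra.
rewrite -cardsT -rsum_const; apply: rsumT_le => j _; exact: h.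
Qed.

Lemma union_bound (I J : finType) (A B : {set I}) (F : J -> {set I}) (b c : R) :
  (forall x, x \in A -> x \in B \/ exists j, x \in F j) ->
  INR #|B| <= b -> (forall j, INR #|F j| <= c) -> INR #|A| <= b + INR #|J| * c.
Proof.
move=> hA hB hF.
have sub : A \subset B :|: \bigcup_j F j.
  apply/subsetP => x /hA[xB|[j xj]]; rewrite inE ?xB //.
  by apply/orP; right; apply/bigcupP; exists j.
apply: Rle_trans (INR_cardm sub) _; apply: Rle_trans (INR_cardU _ _) _.
by apply: Rplus_le_compat => //; apply: INR_card_bigcup.
Qed.

Lemma rsum_exists_ge (I : finType) (Y : {set I}) (g : I -> R) (c : R) :
  (0 < #|Y|)%N -> INR #|Y| * c <= \rsum_(y in Y) g y ->
  exists2 y, y \in Y & c <= g y.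
Proof.
move=> Y0 h; case: (boolP [exists y in Y, rle c (g y)]).
  by case/exists_inP => y yY /rleP; exists y.
move/exists_inPn => hn; exfalso.
case/card_gt0P: Y0 => y0 y0Y.
have : \rsum_(y in Y) g y < \rsum_(y in Y) c.
  rewrite (bigD1 y0) //= [X in _ < X](bigD1 y0) //=.
  have /rleNP h1 := hn _ y0Y.
  have : \rsum_(i in Y | i != y0) g i <= \rsum_(i in Y | i != y0) c.
    by apply: rsumT_le => i /andP[iY _]; have /rleNP := hn _ iY; lra.
  lra.
rewrite rsum_const; lra.
Qed.

(** * Logarithms and weights of primes *)

Lemma ln_ge0 n : 0 <= ln (INR n).
Proof.
(* [ln] takes the default value 0 outside the positive reals, which covers n = 0. *)
case: n => [|n]; first by rewrite /ln /=; case: Rlt_dec => [h|]; [exfalso; lra|lra].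
rewrite -ln_1; have := leq_INR (isT : (1 <= n.+1)%N); case; first by move=> h; left; apply: ln_increasing; [lra|].
by move=> /= <-; right.
Qed.

Lemma ln_le_mono x y : 0 < x -> x <= y -> ln x <= ln y.
Proof. by move=> x0 [h|->]; [left; apply: ln_increasing|right]. Qed.

Definition lw (p : nat) : R := ln (INR p) / INR p.

Definition W (P : seq nat) (E : pred nat) : R := \rsum_(p <- P | E p) lw p.

Lemma lw_ge0 p : 0 <= lw p.
Proof.
rewrite /lw; case: p => [|p]; first by rewrite /Rdiv /= Rinv_0; lra.
by apply: Rle_mult_inv_pos; [exact: ln_ge0|apply: lt_0_INR; lia].
Qed.

Lemma lw_le1 p : lw p <= 1.
Proof.
rewrite /lw; case: p => [|p]; first by rewrite /Rdiv /= Rinv_0; lra.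
have p0 : 0 < INR p.+1 by apply: lt_0_INR; lia.
apply: (Rmult_le_reg_r (INR p.+1)) => //.
rewrite /Rdiv Rmult_assoc Rinv_l; last lra.
have := exp_ineq1_le (ln (INR p.+1)); rewrite exp_ln //; lra.
Qed.

Lemma lwK p : (0 < p)%N -> INR p * lw p = ln (INR p).
Proof. by move=> p0; rewrite /lw; field; apply: not_0_INR; lia. Qed.

Lemma wP_W P : wP P = W P xpredT.
Proof.
rewrite /W; elim: P => [|p P IH]; first by rewrite big_nil.
by rewrite big_cons /= IH /lw Rplus_comm Rplus_comm.
Qed.

Lemma W_sub P (E F : pred nat) : (forall p, p \in P -> E p -> F p) -> W P E <= W P F.
Proof. by move=> h; apply: rsum_sub => // p _; apply: lw_ge0. Qed.

Lemma W_split P (E F : pred nat) :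
  W P E = W P (fun p => E p && F p) + W P (fun p => E p && ~~ F p).
Proof. exact: (bigID F). Qed.

Lemma W_filter P (E F : pred nat) : W [seq p <- P | E p] F = W P (fun p => E p && F p).
Proof. by rewrite /W big_filter_cond. Qed.

Lemma uniq_size_le (P : seq nat) (Q : R) : 0 <= Q -> uniq P ->
  (forall p, p \in P -> (0 < p)%N /\ INR p <= Q) -> INR (size P) <= Q.
Proof.
move=> Q0 uP h; have [-> //|P0] := eqVneq P [::].
have [n nP nmax] : exists2 n, n \in P & forall p, p \in P -> (p <= n)%N.
  clear h Q0 uP; elim: P P0 => // a P IH _.
  have [->|/IH[n nP hn]] := eqVneq P [::].
    by exists a => [|p]; rewrite !inE // => /eqP->.
  case: (leqP a n) => an.
    by exists n => [|p]; rewrite !inE ?nP ?orbT // => /orP[/eqP->|/hn].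
  exists a => [|p]; rewrite !inE ?eqxx // => /orP[/eqP->//|/hn]; lia.
apply: (Rle_trans _ (INR n)); last by case: (h _ nP).
apply: leq_INR; rewrite -[n](size_iota 1); apply: uniq_leq_size => // p pP.
by rewrite mem_iota; have [? _] := h _ pP; have := nmax _ pP; lia.
Qed.

Lemma W_small P M : uniq P -> (forall p, p \in P -> (0 < p)%N) ->
  W P (fun p => p <= M)%N <= INR M.
Proof.
move=> uP h; rewrite /W -big_filter.
apply: (@Rle_trans _ (INR (size [seq p <- P | (p <= M)%N]))); last first.
  apply: uniq_size_le; [exact: pos_INR|exact: filter_uniq|move=> p].
  by rewrite mem_filter => /andP[pM /h ?]; split=> //; apply: leq_INR.
apply: (@Rle_trans _ (\rsum_(p <- [seq p <- P | (p <= M)%N]) 1)).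
  by apply: rsum_le => p _ _; apply: lw_le1.
elim: [seq p <- P | (p <= M)%N] => [|a s IH]; first by rewrite big_nil /=; lra.
rewrite big_cons [size _]/= S_INR; lra.
Qed.

Lemma prod_primes_dvd (P : seq nat) n : uniq P ->
  (forall p, p \in P -> prime p /\ (p %| n)%N) -> (\prod_(p <- P) p %| n)%N.
Proof.
elim: P => [|p P IH]; first by rewrite big_nil dvd1n.
rewrite /= => /andP[pP uP] h; rewrite big_cons.
have [pp pn] := h _ (mem_head _ _).
rewrite Gauss_dvd ?pn /=; first by apply: IH => // q qP; apply: h; rewrite inE qP orbT.
rewrite big_seq; apply: (big_ind (coprime p)) => [|x y|]; first exact: coprimen1.
- by rewrite coprimeMr => -> ->.
move=> q qP; have [qp _] : prime q /\ (q %| n)%N by apply: h; rewrite inE qP orbT.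
rewrite prime_coprime // dvdn_prime2 //.
by apply: contraNneq pP => ->.
Qed.

(** Turns divisibility into size, since distinct primes dividing n have a product at most n. It is
    applied to differences of coordinates, where n <= N, and to values f(x), where n <= N^r. *)
Lemma sum_ln_dvd (P : seq nat) (E : pred nat) n : uniq P ->
  (forall p, p \in P -> prime p) -> (0 < n)%N ->
  (forall p, p \in P -> E p -> (p %| n)%N) ->
  \rsum_(p <- P | E p) ln (INR p) <= ln (INR n).
Proof.
move=> uP hP n0 hE; rewrite -big_filter.
set P' := [seq p <- P | E p].
have uP' : uniq P' by apply: filter_uniq.
have h p : p \in P' -> prime p /\ (p %| n)%N.
  by rewrite mem_filter => /andP[Ep pP]; split; [exact: hP|exact: hE].
have := prod_primes_dvd uP' h; move/(dvdn_leq n0)/leq_INR => le1.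
have [-> pos] : \rsum_(p <- P') ln (INR p) = ln (INR (\prod_(p <- P') p)%N) /\ (0 < \prod_(p <- P') p)%N.
  have : forall p, p \in P' -> (0 < p)%N by move=> p /h[/prime_gt0].
  elim: P' {uP' h le1} => [|p s IH] h; first by rewrite !big_nil /= ln_1.
  rewrite !big_cons muln_gt0 (h _ (mem_head _ _)) /=.
  have [|-> s0] := IH; first by move=> q qs; apply: h; rewrite inE qs orbT.
  split=> //; rewrite -multE mult_INR ln_mult //; apply: lt_0_INR; apply/ltP => //.
  exact: (h _ (mem_head _ _)).
by apply: ln_le_mono => //; apply: lt_0_INR; apply/ltP.
Qed.

(** * Growth estimates for large N *)

Lemma eventually_ln (K : R) : exists N0, forall N, (N0 <= N)%N -> K <= ln (INR N).
Proof.
have [n hn] := INR_unbounded (exp K); exists n => N /leq_INR h.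
rewrite -[K]ln_exp; apply: ln_le_mono; [exact: exp_pos|lra].
Qed.

Lemma eventually_Rpower (K e : R) : 0 < e ->
  exists N0, forall N, (N0 <= N)%N -> K <= Rpower (INR N) e.
Proof.
move=> e0; have [N0 h] := eventually_ln (K / e); exists N0 => N /h h1.
rewrite /Rpower.
have : K <= e * ln (INR N).
  have -> : K = e * (K / e) by field; lra.
  by apply: Rmult_le_compat_l; lra.
have := exp_ineq1_le (e * ln (INR N)); lra.
Qed.

Lemma Rpower_INR_S (N : nat) (x y : R) : (0 < N)%N -> y = x + 1 ->
  INR N * Rpower (INR N) x = Rpower (INR N) y.
Proof.
move=> N0 ->; have h : 0 < INR N by apply: lt_0_INR; apply/ltP.
by rewrite Rpower_plus Rpower_1 //; ring.
Qed.

Lemma Rpower_ge1 (N : nat) (x : R) : 0 <= x -> 1 <= Rpower (INR N) x.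
Proof.
move=> x0; rewrite /Rpower -exp_0; have := Rmult_le_pos _ _ x0 (ln_ge0 N).
by case=> [h|<-]; [left; apply: exp_increasing|right].
Qed.

(** * Residue classes, admissible prime sets and the larger sieve *)

Definition rmod N p (a : 'I_N.+1) : 'I_N.+1 := inord (a %% p).

(* Residue classes modulo p are encoded by their representatives with
   coordinates in [0,p), which again lie in the box [N]^d. *)
Definition red d N p (x : point d N) : point d N := [ffun i => rmod p (x i)].

Lemma rmodE N p (a : 'I_N.+1) : rmod p a = (a %% p)%N :> nat.
Proof. by rewrite /rmod inordK // ltnS (leq_trans (leq_mod _ _)) // -ltnS. Qed.

Lemma redE d N p (x : point d N) i : red p x i = rmod p (x i).
Proof. by rewrite ffunE. Qed.

Lemma nclasses_red d N p (S : {set point d N}) : nclasses p S = #|red p @: S|.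
Proof.
rewrite /nclasses.
pose vals (x : point d N) : {ffun 'I_d -> nat} := [ffun i => (x i : nat)].
have inj : injective vals.
  move=> x y /ffunP h; apply/ffunP => i; apply/val_inj.
  by have := h i; rewrite !ffunE.
have -> : [seq redp p x | x <- enum S] =
    [seq vals x | x <- [seq red p x | x <- enum S]].
  rewrite -map_comp; apply: eq_map => x; apply/ffunP => i.
  by rewrite !ffunE rmodE.
rewrite (undup_map_inj inj) size_map cardE; apply: perm_size.
apply: uniq_perm; [exact: undup_uniq|exact: enum_uniq|move=> y].
rewrite mem_undup mem_enum; apply/mapP/imsetP => [] [x]; rewrite ?mem_enum => xS ->.
  by exists x.
by exists x; rewrite ?mem_enum.
Qed.

Lemma sum_ln_rmod N (P : seq nat) (E : pred nat) (a b : 'I_N.+1) :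
  uniq P -> (forall p, p \in P -> prime p) -> a != b ->
  (forall p, p \in P -> E p -> rmod p a = rmod p b) ->
  \rsum_(p <- P | E p) ln (INR p) <= ln (INR N).
Proof.
move=> uP hP ab hE.
have ab' : (a : nat) <> b by move=> /val_inj /eqP; rewrite (negbTE ab).
have [la lb] := (ltn_ord a, ltn_ord b).
(* In truncated subtraction one summand is 0, so this is |a - b|, at most N. *)
apply: (@Rle_trans _ (ln (INR ((a - b) + (b - a))))); last first.
  by apply: ln_le_mono; [apply: lt_0_INR; lia|apply: leq_INR; lia].
apply: sum_ln_dvd => //; first by lia.
move=> p pP /(hE p pP)/(congr1 val); rewrite /= !rmodE => h.
case: (ltngtP a b) => // h1.
  have -> : (a - b = 0)%N by lia.
  by rewrite add0n -eqn_mod_dvd ?(ltnW h1) // h.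
have -> : (b - a = 0)%N by lia.
by rewrite addn0 -eqn_mod_dvd ?(ltnW h1) // h.
Qed.

(** The bound [adm_W] stands in for Mertens' estimate: it is obtained by thinning the given set of
    primes, and it keeps the second-moment and averaging bounds proportional to log N. *)
Record adm (d : nat) (eps : R) (N : nat) (P : seq nat) : Prop := Adm {
  adm_uniq : uniq P;
  adm_prime : forall p, p \in P -> prime p;
  adm_le : forall p, p \in P -> INR p <= Rpower (INR N) (eps / (2 * INR d));
  adm_W : W P xpredT <= ln (INR N) }.

Lemma adm_gt0 d eps N P p : adm d eps N P -> p \in P -> (0 < p)%N.
Proof. by move=> h /(adm_prime h)/prime_gt0. Qed.

Lemma adm_filter d eps N P E : adm d eps N P -> adm d eps N [seq p <- P | E p].
Proof.
case=> uP prP leP wP; split; first exact: filter_uniq.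
- by move=> p; rewrite mem_filter => /andP[_ /prP].
- by move=> p; rewrite mem_filter => /andP[_ /leP].
rewrite W_filter; apply: Rle_trans wP; exact: W_sub.
Qed.

(** The trivial count of at most Q primes, each with logarithm at most log Q, is enough for the
    diagonal terms of the sieve. *)
Lemma sum_ln_adm d eps N P : (0 < d)%N -> 0 < eps -> adm d eps N P ->
  \rsum_(p <- P) ln (INR p) <=
  Rpower (INR N) (eps / (2 * INR d)) * (eps / (2 * INR d) * ln (INR N)).
Proof.
move=> d0 e0 [uP prP leP _].
set Q := Rpower _ _.
have d0' : 0 < INR d by apply: lt_0_INR; apply/ltP.
have th0 : 0 < eps / (2 * INR d) by apply: Rdiv_lt_0_compat; lra.
have Q0 : 0 < Q by apply: exp_pos.
have sz : INR (size P) <= Q.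
  apply: uniq_size_le => //; first lra.
  by move=> p pP; split; [exact: prime_gt0 (prP _ pP)|exact: leP].
have lnQ : ln Q = eps / (2 * INR d) * ln (INR N) by rewrite /Q /Rpower ln_exp.
rewrite -lnQ.
have lnQ0 : 0 <= ln Q.
  by rewrite lnQ; apply: Rmult_le_pos; [lra|exact: ln_ge0].
apply: (@Rle_trans _ (\rsum_(p <- P) ln Q)).
  apply: rsum_le => p pP _; apply: ln_le_mono; last exact: leP.
  by apply: lt_0_INR; apply/ltP; exact: prime_gt0 (prP _ pP).
apply: (@Rle_trans _ (INR (size P) * ln Q)); last by apply: Rmult_le_compat_r.
clear; elim: P => [|p P IH]; first by rewrite big_nil /=; lra.
rewrite big_cons [size _]/= S_INR; lra.
Qed.

(* Cauchy-Schwarz for the fibres of h, linearised at a free parameter s. *)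
Lemma collision_lower (I J : finType) (h : I -> J) (A : {set I}) (s : R) :
  2 * s * INR #|A| - s * s * INR #|h @: A| <=
  \rsum_(a in A) INR #|[set b in A | h b == h a]|.
Proof.
have E1 : INR #|A| = \rsum_(c in h @: A) INR #|[set b in A | h b == c]|.
  rewrite INR_card (partition_big_imset h) /=; apply: eq_bigr => c _.
  by rewrite INR_card; apply: eq_bigl => b; rewrite inE.
have E2 : \rsum_(a in A) INR #|[set b in A | h b == h a]| =
    \rsum_(c in h @: A) (INR #|[set b in A | h b == c]| * INR #|[set b in A | h b == c]|).
  rewrite (partition_big_imset h) /=; apply: eq_bigr => c _.
  rewrite -rsum_const.
  rewrite [RHS](eq_bigl (fun b => (b \in A) && (h b == c))); last by move=> b; rewrite inE.
  by apply: eq_bigr => b /andP[_ /eqP ->].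
rewrite E2 E1.
have -> : 2 * s * (\rsum_(c in h @: A) INR #|[set b in A | h b == c]|)
   - s * s * INR #|h @: A| =
   \rsum_(c in h @: A) (2 * s * INR #|[set b in A | h b == c]| + - (s * s)).
  rewrite big_split /= rsum_const -big_distrr /=; ring.
apply: rsumT_le => c _; set m := INR _; have := Rle_0_sqr (m - s); rewrite /Rsqr; lra.
Qed.

(* Gallagher's larger sieve, double counting the pairs (a,b) in X with
   a = b mod p, in a form where each point a only sees its own set E a of primes. *)
Lemma larger_sieve d eps N P (X : {set 'I_N.+1}) (E : 'I_N.+1 -> pred nat) (lam delta : R) :
  (0 < d)%N -> 0 < eps -> (1 < N)%N -> adm d eps N P -> 0 < lam -> 0 < delta ->
  2 * delta <= lam * lam ->
  (forall a, a \in X -> lam * ln (INR N) <= W P (E a)) ->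
  (forall p, p \in P -> INR #|rmod p @: [set a in X | E a p]| <= delta * INR p) ->
  INR #|X| <= eps / (2 * INR d) * Rpower (INR N) (eps / (2 * INR d)).
Proof.
move=> d0 e0 N1 aP lam0 del0 hdel hE hB.
set n := INR #|X|; set L := ln (INR N) in hE *.
set Q := Rpower _ _; set th := eps / _.
have L0 : 0 < L.
  by rewrite /L -ln_1; apply: ln_increasing; [lra|apply: (lt_INR 1); apply/ltP].
have d0' : 0 < INR d by apply: lt_0_INR; apply/ltP.
have th0 : 0 < th by apply: Rdiv_lt_0_compat; lra.
have n0 : 0 <= n by apply: pos_INR.
have Q0 : 0 < Q by apply: exp_pos.
case: (Req_dec n 0) => [->|nn0]; first by apply: Rmult_le_pos; lra.
pose C p a b := [&& E a p, E b p & rmod p b == rmod p a].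
pose T := \rsum_(p <- P) (ln (INR p) * \rsum_(a in X) \rsum_(b in X) (if C p a b then 1 else 0)).
(* A pair a != b is counted with primes dividing a - b, of total logarithm at most L; a diagonal
   pair costs at most the full sum of log p. *)
have up : T <= n * n * L + n * (Q * (th * L)).
  have -> : T = \rsum_(a in X) \rsum_(b in X) \rsum_(p <- P | C p a b) ln (INR p).
    rewrite /T (eq_bigr (fun p => \rsum_(a in X) \rsum_(b in X) (if C p a b then ln (INR p) else 0))).
      rewrite exchange_big /=; apply: eq_bigr => a _.
      rewrite exchange_big /=; apply: eq_bigr => b _.
      by rewrite -big_mkcond.
    move=> p _; rewrite big_distrr /=; apply: eq_bigr => a _.
    rewrite big_distrr /=; apply: eq_bigr => b _.
    by case: (C p a b); rewrite ?Rmult_1_r ?Rmult_0_r.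
  apply: (@Rle_trans _ (\rsum_(a in X) (n * L + Q * (th * L)))); last first.
    rewrite rsum_const -/n; lra.
  apply: rsumT_le => a aX.
  rewrite (bigD1 a) //= Rplus_comm; apply: Rplus_le_compat; last first.
    apply: Rle_trans (sum_ln_adm d0 e0 aP).
    by apply: rsum_sub => // p _; apply: ln_ge0.
  apply: (@Rle_trans _ (\rsum_(b in X) L)); last by rewrite rsum_const -/n; lra.
  apply: (@Rle_trans _ (\rsum_(b in X | b != a) L)).
    apply: rsumT_le => b /andP[bX ba].
    apply: (sum_ln_rmod (a := b) (b := a)) => //; [exact: adm_uniq aP|exact: adm_prime aP|].
    by move=> p _ /and3P[_ _ /eqP].
  by apply: rsum_sub => [b _|b _ /andP[]//]; lra.
have lo : lam * lam / delta * n * n * L <= T.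
  apply: (@Rle_trans _ (\rsum_(p <- P) (2 * (lam / delta) * n * (lw p * INR #|[set a in X | E a p]|)
     + - ((lam / delta) * (lam / delta) * n * n * delta) * lw p))).
    rewrite big_split /= -!big_distrr /=.
    pose Sm := \rsum_(p <- P) (lw p * INR #|[set a in X | E a p]|).
    rewrite -/(W P xpredT) -/Sm.
    have h1 : n * (lam * L) <= Sm.
      rewrite /Sm (eq_bigr (fun p => \rsum_(a in X) (if E a p then lw p else 0))); last first.
        by move=> p _; rewrite rsum_indic; ring.
      rewrite exchange_big /= -rsum_const; apply: rsumT_le => a aX.
      by rewrite -big_mkcond; apply: hE.
    have h2 := adm_W aP; rewrite -/L in h2.
    have ld0 : 0 < lam / delta by apply: Rdiv_lt_0_compat.
    have : 2 * (lam / delta) * n * (n * (lam * L)) <= 2 * (lam / delta) * n * Sm.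
      apply: Rmult_le_compat_l => //; apply: Rmult_le_pos => //; lra.
    have : (lam / delta * (lam / delta) * n * n * delta) * W P xpredT <= (lam / delta * (lam / delta) * n * n * delta) * L.
      apply: Rmult_le_compat_l => //; apply: Rmult_le_pos; last lra.
      by do 2 (apply: Rmult_le_pos => //); apply: Rmult_le_pos; lra.
    have -> : lam / delta * (lam / delta) * n * n * delta = lam * lam / delta * n * n by field; lra.
    have -> : 2 * (lam / delta) * n * (n * (lam * L)) = 2 * (lam * lam / delta * n * n * L) by field; lra.
    lra.
  apply: rsum_le => p pP _.
  have p0 : (0 < p)%N := adm_gt0 aP pP.
  have p0' : 0 < INR p by apply: lt_0_INR; apply/ltP.
  set Xp := [set a in X | E a p].
  have -> : \rsum_(a in X) \rsum_(b in X) (if C p a b then 1 else 0) =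
     \rsum_(a in Xp) INR #|[set b in Xp | rmod p b == rmod p a]|.
    rewrite [RHS](eq_bigl (fun a => (a \in X) && E a p)); last by move=> a; rewrite inE.
    rewrite [RHS]big_mkcondr; apply: eq_bigr => a _.
    rewrite rsum_indic Rmult_1_r /C; case: (E a p) => /=.
      by congr (INR #|pred_of_set _|); apply/setP => b; rewrite !inE andbA.
    by rewrite (_ : [set _ in X | false] = set0) ?cards0 //; apply/setP => b; rewrite !inE andbF.
  (* The free parameter is the expected fibre size: on average about lam n points of X see p, and
     they lie in at most delta p classes. *)
  have := collision_lower (rmod p) Xp (lam / delta * n / INR p).
  set S := \rsum_(a in Xp) _; move=> h.
  have h3 := hB _ pP; rewrite -/Xp in h3.
  rewrite -(lwK p0).
  apply: (@Rle_trans _ (INR p * lw p * (2 * (lam / delta * n / INR p) * INR #|Xp| -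
     lam / delta * n / INR p * (lam / delta * n / INR p) * (delta * INR p)))).
    right; field; lra.
  apply: Rmult_le_compat_l.
    by apply: Rmult_le_pos; [lra|exact: lw_ge0].
  apply: Rle_trans h; apply: Rplus_le_compat_l; apply: Ropp_le_contravar.
  by apply: Rmult_le_compat_l => //; exact: Rle_0_sqr.
(* This ratio makes the lower bound at least 2 n^2 L, twice the off-diagonal upper bound, so n^2 L
   is at most the diagonal term. *)
have h2 : 2 <= lam * lam / delta.
  apply: (Rmult_le_reg_r delta) => //.
  have -> : lam * lam / delta * delta = lam * lam by field; lra.
  lra.
have nn : 0 < n by lra.
have : 2 * (n * n * L) <= lam * lam / delta * (n * n * L).
  apply: Rmult_le_compat_r => //; do !(apply: Rmult_le_pos); lra.
move=> h3.
have h4 : n * n * L <= n * (Q * (th * L)) by lra.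
apply: (Rmult_le_reg_r (n * L)); first by apply: Rmult_lt_0_compat.
lra.
Qed.

(** * Fibres and the sieve in several coordinates *)

Definition fib d N (i : 'I_d) (a : 'I_N.+1) (Y : {set point d N}) := [set x in Y | x i == a].

Lemma fib_sub d N i a (Y : {set point d N}) : fib i a Y \subset Y.
Proof. by apply/subsetP => x; rewrite inE => /andP[]. Qed.

Lemma card_box d N (A : 'I_d -> {set 'I_N.+1}) (c : R) : 0 <= c ->
  (forall i, INR #|A i| <= c) ->
  INR #|[set x : point d N | [forall i, x i \in A i]]| <= c ^ d.
Proof.
move=> c0 h.
have -> : #|[set x : point d N | [forall i, x i \in A i]]| =
   foldr muln 1%N [seq #|A i| | i : 'I_d].
  rewrite -(card_family (fun i => mem (A i))) cardsE; apply: eq_card => x.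
  by rewrite !inE; apply/forallP/familyP.
have -> : c ^ d = c ^ size (enum 'I_d : seq 'I_d) by rewrite size_enum_ord.
rewrite /image_mem; elim: (enum _) => [|i s IH]; first by rewrite /=; lra.
rewrite /= -multE mult_INR; apply: Rmult_le_compat => //; exact: pos_INR.
Qed.

Lemma card_small_fibers d N i (Y : {set point d N}) (t : R) : 0 <= t ->
  INR #|[set x in Y | ~~ rle t (INR #|fib i (x i) Y|)]| <= INR N.+1 * t.
Proof.
move=> t0; pose F a := if rle t (INR #|fib i a Y|) then set0 else fib i a Y.
apply: Rle_trans (_ : INR #|\bigcup_a F a| <= _).
  apply: INR_cardm; apply/subsetP => x; rewrite inE => /andP[xY /negbTE h].
  by apply/bigcupP; exists (x i) => //; rewrite /F h inE xY eqxx.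
rewrite -[in INR N.+1](card_ord N.+1); apply: INR_card_bigcup => a; rewrite /F.
by case: rleP => [h|/Rnot_le_lt h]; [rewrite cards0|left].
Qed.

Lemma Rpower_theta d N eps : (0 < d)%N ->
  Rpower (INR N) (eps / (2 * INR d)) ^ d = Rpower (INR N) (eps / 2).
Proof.
move=> d0; have d0' : 0 < INR d by apply: lt_0_INR; apply/ltP.
rewrite -Rpower_pow; last exact: exp_pos.
by rewrite Rpower_mult; congr Rpower; field; lra.
Qed.

(** Makes a box with sides O(Q), which has O(N^(eps/2)) points by [Rpower_theta], negligible against
    c N^(k+eps). *)
Lemma eventually_half (K c eps : R) (k : nat) : 0 < c -> 0 < eps ->
  exists N0, forall N, (N0 <= N)%N ->
    K * Rpower (INR N) (eps / 2) <= c * Rpower (INR N) (INR k + eps).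
Proof.
move=> c0 e0; have [N0 h] := @eventually_Rpower (K / c) (eps / 2) ltac:(lra).
exists N0 => N hN; have h1 := h _ hN.
have -> : INR k + eps = INR k + (eps / 2 + eps / 2) by field.
rewrite !Rpower_plus.
have h2 : 1 <= Rpower (INR N) (INR k) by apply: Rpower_ge1; apply: pos_INR.
set z := Rpower _ (eps / 2) in h1 *; have z0 : 0 < z by apply: exp_pos.
have h3 : K <= c * z.
  have -> : K = c * (K / c) by field; lra.
  by apply: Rmult_le_compat_l; lra.
have h4 : K * z <= c * z * z by apply: Rmult_le_compat_r; lra.
have : 0 <= c * z * z by do !apply: Rmult_le_pos; lra.
move=> h5; have : 1 * (c * z * z) <= Rpower (INR N) (INR k) * (c * z * z).
  by apply: Rmult_le_compat_r.
lra.
Qed.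

(** Induction on k. A coordinate value with a large fibre has c1 p^k classes in that fibre for many
    p. If the whole image had fewer than c p^(k+1) classes for most p, these values would occupy at
    most delta p residues, and [larger_sieve] would leave O(Q) of them in every coordinate. Then Y
    would consist of a box of O(N^(eps/2)) points and of points on small fibres, which is too
    few. *)
Lemma robust_sieve d eps : (0 < d)%N -> 0 < eps ->
  forall k lam c0, 0 < lam -> 0 < c0 ->
  exists2 c, 0 < c & exists N0, forall N, (N0 <= N)%N ->
  forall P, adm d eps N P ->
  forall (Y : {set point d N}) (E : point d N -> pred nat),
  c0 * Rpower (INR N) (INR k - 1 + eps) <= INR #|Y| ->
  (forall x, x \in Y -> lam * ln (INR N) <= W P (E x)) ->
  c * ln (INR N) <=
  W P (fun p => rle (c * INR p ^ k) (INR #|red p @: [set x in Y | E x p]|)).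
Proof.
move=> d0 e0; have d0' : 0 < INR d by apply: lt_0_INR; apply/ltP.
elim=> [|k IH] lam c0 lam0 c00.
  exists (Rmin lam 1); first by apply: Rmin_glb_lt; lra.
  exists 0%N => N _ P aP Y E hY hE.
  have /ltP/card_gt0P[x xY] : (0 < #|Y|)%coq_nat.
    apply: INR_lt; apply: Rlt_le_trans hY; apply: Rmult_lt_0_compat => //; exact: exp_pos.
  apply: (@Rle_trans _ (lam * ln (INR N))).
    by apply: Rmult_le_compat_r; [exact: ln_ge0|exact: Rmin_l].
  apply: Rle_trans (hE _ xY) _; apply: W_sub => p pP Ep; apply/rleP.
  apply: (@Rle_trans _ 1); first by rewrite /= Rmult_1_r; exact: Rmin_r.
  apply: (leq_INR (m := 1)); apply/card_gt0P; exists (red p x).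
  by apply: imset_f; rewrite inE xY.
(* The divisor 4d makes the points on small fibres, over all d coordinates, at most half of the
   lower bound for Y. *)
have [|c1 c10 [N1 h1]] := IH lam (c0 / (4 * INR d)) lam0.
  by apply: Rdiv_lt_0_compat; lra.
pose delta := c1 * c1 / 8.
have del0 : 0 < delta by rewrite /delta; nra.
pose th := eps / (2 * INR d).
have th0 : 0 < th by apply: Rdiv_lt_0_compat; lra.
have [N2 h2] := @eventually_half (th ^ d + 1) (c0 / 2) eps k ltac:(lra) e0.
(* [delta * c1] bounds the residues with rich fibres by delta p; [c1 / 2] leaves weight c1/2 log N
   of primes with a rich fibre but a poor total image, and 2 delta = (c1/2)^2 is what [larger_sieve]
   asks. *)
exists (Rmin (delta * c1) (c1 / 2)).
  by apply: Rmin_glb_lt; [apply: Rmult_lt_0_compat|lra].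
set c := Rmin _ _.
have cl : c <= delta * c1 := Rmin_l _ _.
have cr : c <= c1 / 2 := Rmin_r _ _.
exists (maxn (maxn N1 N2) 2) => N; rewrite !geq_max => /andP[/andP[hN1 hN2] hN3] P aP Y E hY hE.
have L0 := ln_ge0 N; set L := ln (INR N) in L0 hE *.
apply: Rnot_lt_le => hlt.
pose n p := INR #|red p @: [set x in Y | E x p]|.
pose t := c0 / (4 * INR d) * Rpower (INR N) (INR k - 1 + eps).
have t0 : 0 < t.
  by apply: Rmult_lt_0_compat; [apply: Rdiv_lt_0_compat; lra|exact: exp_pos].
pose A i := [set a : 'I_N.+1 | rle t (INR #|fib i a Y|)].
pose m i a p := INR #|red p @: [set x in fib i a Y | E x p]|.
have hA i : INR #|A i| <= th * Rpower (INR N) th.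
  pose E2 (a : 'I_N.+1) p := rle (c1 * INR p ^ k) (m i a p) && ~~ rle (c * INR p ^ k.+1) (n p).
  apply: (@larger_sieve d eps N P (A i) E2 (c1 / 2) delta) => //; first lra.
  - rewrite /delta; lra.
  - move=> a; rewrite inE => /rleP ha.
    have := h1 N hN1 P aP (fib i a Y) E ha.
    have hs : forall x, x \in fib i a Y -> lam * ln (INR N) <= W P (E x).
      by move=> x /(subsetP (fib_sub _ _ _)); apply: hE.
    move/(_ hs) => h3'.
    pose F p := rle (c * INR p ^ k.+1) (n p).
    have h3 : c1 * L <= W P (fun p => rle (c1 * INR p ^ k) (m i a p) && F p) + W P (E2 a).
      by rewrite /E2 -(W_split P (fun p => rle (c1 * INR p ^ k) (m i a p)) F).
    have h4 : W P (fun p => rle (c1 * INR p ^ k) (m i a p) && F p) <= W P F.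
      by apply: W_sub => p _ /andP[].
    have h5 : c * L <= c1 / 2 * L by apply: Rmult_le_compat_r.
    have h6 : W P F < c * L := hlt.
    by rewrite -/L; lra.
  - move=> p pP.
    have p0 : 0 < INR p by apply: lt_0_INR; apply/ltP; exact: adm_gt0 aP pP.
    have pk0 : 0 < INR p ^ k by apply: pow_lt.
    set B := rmod p @: _.
    case: (set_0Vmem B) => [->|[b bB]].
      by rewrite cards0; apply: Rmult_le_pos; lra.
    have hnp : n p < c * INR p ^ k.+1.
      by case/imsetP: bB => a; rewrite inE => /andP[_ /andP[_ /rleNP]].
    have : INR #|B| * (c1 * INR p ^ k) <= n p.
      pose G b := [set y in red p @: [set x in Y | E x p] | y i == b].
      have E3 : n p = \rsum_(b | true) INR #|G b|.
        rewrite /n INR_card (partition_big (fun y : point d N => y i) xpredT) //=.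
        by apply: eq_bigr => b' _; rewrite INR_card; apply: eq_bigl => y; rewrite inE.
      rewrite E3 -rsum_const.
      apply: (@Rle_trans _ (\rsum_(b in B) INR #|G b|)); last first.
        by apply: rsum_sub => // b' _; apply: pos_INR.
      apply: rsumT_le => b' /imsetP[a]; rewrite inE => /andP[_ /andP[/rleP h3 _]] ->.
      apply: Rle_trans h3 _; apply: INR_cardm; apply/subsetP => y /imsetP[x].
      rewrite !inE => /andP[/andP[xY /eqP xa] Ex] ->; rewrite redE xa eqxx andbT.
      by apply: imset_f; rewrite inE xY.
    move=> h3.
    have h4 : c * INR p ^ k.+1 <= delta * INR p * (c1 * INR p ^ k).
      have -> : delta * INR p * (c1 * INR p ^ k) = delta * c1 * INR p ^ k.+1 by rewrite /=; ring.
      by apply: Rmult_le_compat_r => //; left; apply: pow_lt.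
    apply: (Rmult_le_reg_r (c1 * INR p ^ k)); first by apply: Rmult_lt_0_compat.
    lra.
have N0' : (0 < N)%N by lia.
pose box := [set x : point d N | [forall i, x i \in A i]].
pose sm i := [set x in Y | ~~ rle t (INR #|fib i (x i) Y|)].
have Q0 : 0 < Rpower (INR N) th := exp_pos _.
have u3 : INR #|box| <= th ^ d * Rpower (INR N) (eps / 2).
  rewrite -(Rpower_theta N eps d0) -Rpow_mult_distr; apply: card_box => //.
  by apply: Rmult_le_pos; [lra|left; exact: exp_pos].
have u4 : INR #|Y| <= th ^ d * Rpower (INR N) (eps / 2) + INR #|'I_d| * (INR N.+1 * t).
  apply: (union_bound (B := box) (F := sm)) => // [x xY|i]; last first.
    by apply: card_small_fibers; lra.
  case: (boolP (x \in box)); first by left.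
  rewrite inE => /forallPn[i]; rewrite inE => hi.
  by right; exists i; rewrite inE xY.
rewrite card_ord in u4.
have u5 : INR N.+1 * t <= 2 * INR N * t.
  apply: Rmult_le_compat_r; first lra.
  have n1 : 1 <= INR N := leq_INR N0'.
  rewrite S_INR; lra.
have u6 : INR N * t = c0 / (4 * INR d) * Rpower (INR N) (INR k + eps).
  rewrite /t -(@Rpower_INR_S N (INR k - 1 + eps) (INR k + eps)) //; last ring.
  ring.
have u7 : INR d * (INR N.+1 * t) <= c0 / 2 * Rpower (INR N) (INR k + eps).
  apply: (@Rle_trans _ (INR d * (2 * INR N * t))).
    by apply: Rmult_le_compat_l; lra.
  right; rewrite Rmult_assoc u6; field; lra.
have u8 := h2 N hN2.
have u9 : 0 < Rpower (INR N) (eps / 2) := exp_pos _.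
have hY' : c0 * Rpower (INR N) (INR k + eps) <= INR #|Y|.
  by move: hY; rewrite S_INR (_ : INR k + 1 - 1 + eps = INR k + eps) //; ring.
lra.
Qed.

(** * Hits by fibres and greedy covering *)

Definition hits d N i p (Y : {set point d N}) (a : 'I_N.+1) (x : point d N) : bool :=
  red p x \in red p @: fib i a Y.

Lemma card_small_fibers_le d N eps k c i (Y Z : {set point d N}) :
  0 < c -> (0 < N)%N -> c * Rpower (INR N) (INR k + eps) <= INR #|Y| ->
  INR #|[set x in Z | ~~ rle (c / 16 * Rpower (INR N) (INR k - 1 + eps)) (INR #|fib i (x i) Z|)]|
  <= INR #|Y| / 8.
Proof.
move=> c0 N0 hY; set t := _ * _.
have t0 : 0 < t by apply: Rmult_lt_0_compat; [lra|exact: exp_pos].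
apply: Rle_trans (card_small_fibers i Z (Rlt_le _ _ t0)) _.
have n1 : 1 <= INR N := leq_INR N0.
apply: (@Rle_trans _ (2 * (INR N * t))).
  rewrite -Rmult_assoc; apply: Rmult_le_compat_r; first lra.
  rewrite S_INR; lra.
have -> : INR N * t = c / 16 * Rpower (INR N) (INR k + eps).
  rewrite /t -(@Rpower_INR_S N (INR k - 1 + eps) (INR k + eps)) //; last ring.
  ring.
lra.
Qed.

(** Contradiction by double counting. Otherwise more than half of Y, the set Z, sees fewer than c2
    |Y| / p hits at primes of weight lam/2 log N. By [robust_sieve] the fibre of Z over y_i then
    meets at least c p^k classes for many p and a positive proportion of y; yet there are at most
    alpha p^(k+1) classes, each met by the fibres of fewer than c2 |Y| / p points y. *)
Lemma typical_hits d eps k lam alpha c0 :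
  (0 < d)%N -> 0 < eps -> 0 < lam -> 0 < alpha -> 0 < c0 ->
  exists2 c2, 0 < c2 & exists N0, forall N, (N0 <= N)%N ->
  forall P, adm d eps N P ->
  forall i (Y : {set point d N}) (E : point d N -> pred nat),
  c0 * Rpower (INR N) (INR k + eps) <= INR #|Y| ->
  (forall p, p \in P -> INR #|red p @: Y| <= alpha * INR p ^ k.+1) ->
  (forall x, x \in Y -> lam * ln (INR N) <= W P (E x)) ->
  INR #|Y| <= 2 * INR #|[set x in Y | rle (lam / 2 * ln (INR N))
     (W P (fun p => E x p && rle (c2 * INR #|Y|)
        (INR p * INR #|[set y in Y | hits i p Y (y i) x]|)))]|.
Proof.
move=> d0 e0 lam0 al0 c00.
have [c c_gt0 [N1 h1]] := @robust_sieve d eps d0 e0 k (lam / 2) (c0 / 16) ltac:(lra) ltac:(lra).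
(* With this value the upper count is c^2/8 |Y| log N, while the lower one is c^2 |B| log N with |B|
   > |Y|/4. *)
pose c2 := c * c / (8 * alpha).
have c20 : 0 < c2 by apply: Rdiv_lt_0_compat; nra.
exists c2 => //; exists (maxn N1 2) => N; rewrite geq_max => /andP[hN1 hN2] P aP i Y E hY hYp hE.
have L0 : 0 < ln (INR N).
  by rewrite -ln_1; apply: ln_increasing; [lra|apply: (lt_INR 1); apply/ltP].
set L := ln (INR N) in hE L0 *.
pose H p x := INR #|[set y in Y | hits i p Y (y i) x]|.
set G := [set x in Y | _].
apply: Rnot_lt_le => hlt.
have Y0 : 0 < INR #|Y|.
  by apply: Rlt_le_trans hY; apply: Rmult_lt_0_compat => //; exact: exp_pos.
pose E' x p := E x p && ~~ rle (c2 * INR #|Y|) (INR p * H p x).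
pose Z := Y :\: G.
have ZY x : x \in Z -> x \in Y by rewrite inE => /andP[].
have hE' x : x \in Z -> lam / 2 * L <= W P (E' x).
  move=> xZ; have xY := ZY _ xZ; move: xZ; rewrite !inE xY andbT => /rleNP h2.
  have := hE _ xY; rewrite (W_split P (E x) (fun p => rle (c2 * INR #|Y|) (INR p * H p x))).
  rewrite /E' /H in h2 *; lra.
have cZ : INR #|Y| = INR #|G| + INR #|Z|.
  rewrite -plus_INR; congr INR; rewrite plusE /Z cardsD.
  have GY : G \subset Y by apply/subsetP => x; rewrite inE => /andP[].
  by rewrite (setIidPr GY) subnKC // subset_leq_card.
pose t := c0 / 16 * Rpower (INR N) (INR k - 1 + eps).
pose B := [set x in Z | rle t (INR #|fib i (x i) Z|)].
have cB : INR #|Z| <= INR #|B| + INR #|Y| / 8.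
  have h2 := @card_small_fibers_le d N eps k c0 i Y Z c00 (ltnW hN2) hY.
  apply: Rle_trans (_ : INR #|B| + INR #|Z :\: B| <= _).
    rewrite -plus_INR; apply: leq_INR; rewrite plusE -leq_subLR -cardsDS //.
    by apply/subsetP => x; rewrite inE => /andP[].
  apply: Rplus_le_compat_l; apply: Rle_trans h2; apply: INR_cardm.
  by apply/subsetP => x; rewrite !inE => /andP[h3 xZ]; move: h3; rewrite xZ.
pose K a p := [set x in fib i a Z | E' x p].
pose n a p := INR #|red p @: K a p|.
have hB y : y \in B -> c * (c * L) <= \rsum_(p <- P) (lw p * (n (y i) p / INR p ^ k)).
  rewrite inE => /andP[yZ /rleP hy].
  have := h1 N hN1 P aP (fib i (y i) Z) E' hy.
  have hs x : x \in fib i (y i) Z -> lam / 2 * L <= W P (E' x).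
    by move=> /(subsetP (fib_sub _ _ _)); apply: hE'.
  move/(_ hs) => h3.
  apply: (@Rle_trans _ (c * W P (fun p => rle (c * INR p ^ k) (n (y i) p)))).
    by apply: Rmult_le_compat_l => //; left.
  rewrite /W big_distrr /= big_mkcond /=; apply: rsum_le => p pP _.
  have pk : 0 < INR p ^ k.
    by apply: pow_lt; apply: lt_0_INR; apply/ltP; exact: adm_gt0 aP pP.
  case: rleP => h4; last first.
    apply: Rmult_le_pos; first exact: lw_ge0.
    by apply: Rle_mult_inv_pos => //; apply: pos_INR.
  rewrite Rmult_comm; apply: Rmult_le_compat_l; first exact: lw_ge0.
  apply: (Rmult_le_reg_r (INR p ^ k)) => //.
  have -> : n (y i) p / INR p ^ k * INR p ^ k = n (y i) p by field; lra.
  exact: h4.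
have lo : INR #|B| * (c * (c * L)) <=
    \rsum_(p <- P) (lw p / INR p ^ k * \rsum_(y in Y) n (y i) p).
  rewrite -rsum_const.
  rewrite (eq_bigr (fun p : nat => \rsum_(y in Y) (lw p * (n (y i) p / INR p ^ k)))); last first.
    move=> p _; rewrite big_distrr /=; apply: eq_bigr => y _; rewrite /Rdiv; ring.
  rewrite exchange_big /=.
  apply: (@Rle_trans _ (\rsum_(y in B) \rsum_(p <- P) (lw p * (n (y i) p / INR p ^ k)))).
    by apply: rsumT_le => y; apply: hB.
  apply: rsum_sub => y _; last by rewrite inE => /andP[/ZY].
  apply: rsum_ge0 => p pP _; apply: Rmult_le_pos; first exact: lw_ge0.
  apply: Rle_mult_inv_pos; first exact: pos_INR.
  by apply: pow_lt; apply: lt_0_INR; apply/ltP; exact: adm_gt0 aP pP.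
have up : \rsum_(p <- P) (lw p / INR p ^ k * \rsum_(y in Y) n (y i) p) <= alpha * c2 * INR #|Y| * L.
  apply: (@Rle_trans _ (\rsum_(p <- P) (alpha * c2 * INR #|Y| * lw p))); last first.
    rewrite -big_distrr /=; apply: Rmult_le_compat_l; last exact: adm_W aP.
    by apply: Rmult_le_pos; [apply: Rmult_le_pos; lra|exact: pos_INR].
  apply: rsum_le => p pP _.
  have p0 : 0 < INR p by apply: lt_0_INR; apply/ltP; exact: adm_gt0 aP pP.
  have pk : 0 < INR p ^ k by apply: pow_lt.
  pose C := red p @: [set x in Z | E' x p].
  have hC : INR #|C| <= alpha * INR p ^ k.+1.
    apply: Rle_trans (hYp _ pP); apply: INR_cardm; apply: imsetS.
    by apply/subsetP => x; rewrite inE => /andP[/ZY].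
  have hs : \rsum_(y in Y) n (y i) p <= INR #|C| * (c2 * INR #|Y| / INR p).
    rewrite (eq_bigr (fun y : point d N => \rsum_(z in C) (if z \in red p @: K (y i) p then 1 else 0))); last first.
      move=> y _; rewrite (rsum_indic _ (fun z => z \in red p @: K (y i) p)) Rmult_1_r; congr (INR #|pred_of_set _|).
      apply/setP => z; rewrite inE andb_idl // => /imsetP[x]; rewrite !inE.
      by move=> /andP[/andP[xZ _] xE] ->; apply: imset_f; rewrite !inE xE andbT.
    rewrite exchange_big -rsum_const /=; apply: rsumT_le => z /imsetP[x0].
    rewrite inE => /andP[_ /andP[_ /rleNP hx]] zE.
    rewrite rsum_indic Rmult_1_r.
    apply: (@Rle_trans _ (H p x0)); last first.
      apply: (Rmult_le_reg_l (INR p)) => //.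
      have -> : INR p * (c2 * INR #|Y| / INR p) = c2 * INR #|Y| by field; lra.
      lra.
    apply: INR_cardm; apply/subsetP => y; rewrite !inE => /andP[-> /imsetP[x]].
    rewrite inE => /andP[]; rewrite inE => /andP[/ZY xY xa] _ zx; rewrite /hits -zE zx /=.
    by apply: imset_f; rewrite inE xY.
  have hs2 : \rsum_(y in Y) n (y i) p <= alpha * INR p ^ k.+1 * (c2 * INR #|Y| / INR p).
    apply: Rle_trans hs _; apply: Rmult_le_compat_r => //.
    by apply: Rle_mult_inv_pos => //; apply: Rmult_le_pos; [lra|exact: pos_INR].
  apply: (@Rle_trans _ (lw p / INR p ^ k * (alpha * INR p ^ k.+1 * (c2 * INR #|Y| / INR p)))).
    apply: Rmult_le_compat_l => //; apply: Rle_mult_inv_pos => //; exact: lw_ge0.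
  by right; rewrite /=; field; lra.
have E2 : alpha * c2 = c * c / 8 by rewrite /c2; field; lra.
rewrite E2 in up.
have h5 := Rle_trans _ _ _ lo up.
have h6 : INR #|Y| / 4 < INR #|B| by lra.
have cc : 0 < c * (c * L) by do 2 (apply: Rmult_lt_0_compat => //).
have h7 : INR #|Y| / 4 * (c * (c * L)) < INR #|B| * (c * (c * L)).
  by apply: Rmult_lt_compat_r.
have h8 : 0 < INR #|Y| * (c * (c * L)) by apply: Rmult_lt_0_compat.
lra.
Qed.

(** Primes up to M weigh at most M in total, and beyond M one has log p / p <= log p / M. So primes
    whose logarithms sum to O(log N) weigh only a small fraction of log N, for M a large
    constant. *)
Lemma W_le_sum_ln (P : seq nat) (E : pred nat) (M : nat) :
  uniq P -> (forall p, p \in P -> prime p) -> (0 < M)%N ->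
  W P E <= INR M + (\rsum_(p <- P | E p) ln (INR p)) / INR M.
Proof.
move=> uP prP M0; have M0' : 0 < INR M by apply: lt_0_INR; apply/ltP.
rewrite (W_split P E (fun p => p <= M)%N); apply: Rplus_le_compat.
  apply: Rle_trans (W_small M uP _); first by apply: W_sub => p _ /andP[].
  by move=> p /prP/prime_gt0.
rewrite /Rdiv Rmult_comm big_distrr /=.
apply: (@Rle_trans _ (\rsum_(p <- P | E p && ~~ (p <= M)%N) (/ INR M * ln (INR p)))).
  apply: rsum_le => p pP /andP[_]; rewrite -ltnNge => Mp.
  rewrite /lw /Rdiv Rmult_comm; apply: Rmult_le_compat_r; first exact: ln_ge0.
  by apply: Rinv_le_contravar => //; apply: leq_INR; apply: ltnW.
apply: rsum_sub => [p _|p _ /andP[]//].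
by apply: Rmult_le_pos; [left; apply: Rinv_0_lt_compat|exact: ln_ge0].
Qed.

(* Weight of the primes modulo which x is hit by some fibre x_i = a with a in s;
   fibres through x itself are excluded so that each fibre contributes at most log N. *)
Definition cov d N (i : 'I_d) (P : seq nat) (U : {set point d N}) (s : seq 'I_N.+1)
    (x : point d N) : R :=
  \rsum_(p <- P | has (fun a => (a != x i) && hits i p U a x) s) ln (INR p).

Lemma hits_rmod d N i p (U : {set point d N}) a x : hits i p U a x -> rmod p a = rmod p (x i).
Proof.
case/imsetP => u; rewrite inE => /andP[_ /eqP <-] /ffunP/(_ i).
by rewrite !redE.
Qed.

Lemma hits_sub d N i p (U V : {set point d N}) a x : U \subset V -> hits i p U a x -> hits i p V a x.
Proof.
move=> /subsetP UV; case/imsetP => u; rewrite inE => /andP[/UV uV ua] xE.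
by rewrite /hits xE; apply: imset_f; rewrite inE uV.
Qed.

Section GreedyStep.
Variables (d N : nat) (i : 'I_d) (P : seq nat) (U : {set point d N}).

Let covered (s : seq 'I_N.+1) p (x : point d N) := has (fun a => (a != x i) && hits i p U a x) s.

Definition gain (s : seq 'I_N.+1) (a : 'I_N.+1) (x : point d N) : R :=
  \rsum_(p <- P | ~~ covered s p x && ((a != x i) && hits i p U a x)) ln (INR p).

Lemma cov_cons s a x : cov i P U (a :: s) x = cov i P U s x + gain s a x.
Proof.
rewrite /cov (bigID (fun p => covered s p x)) /=; congr (_ + _).
  by apply: eq_bigl => p; rewrite /covered; case: (has _ s); rewrite ?orbT ?andbF.
by apply: eq_bigl => p; rewrite /covered; case: (has _ s); rewrite ?orbT ?andbF // orbF andbT.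
Qed.

Lemma cov_ge0 s x : 0 <= cov i P U s x.
Proof. by apply: rsum_ge0 => p _ _; apply: ln_ge0. Qed.

Lemma gain_ge0 s a x : 0 <= gain s a x.
Proof. by apply: rsum_ge0 => p _ _; apply: ln_ge0. Qed.

Lemma gain_le s a x : uniq P -> (forall p, p \in P -> prime p) -> gain s a x <= ln (INR N).
Proof.
move=> uP prP; have [ax|ax] := eqVneq a (x i).
  rewrite /gain big_pred0 => [|p]; first exact: ln_ge0.
  by rewrite ax eqxx /= andbF.
apply: (sum_ln_rmod (a := a) (b := x i)) => // p _ /and3P[_ _].
exact: hits_rmod.
Qed.

Lemma W_uncovered kap M s x : uniq P -> (forall p, p \in P -> prime p) -> (0 < M)%N ->
  kap <= W P xpredT ->
  kap - INR M - cov i P U s x / INR M <= W P (fun p => ~~ covered s p x).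
Proof.
move=> uP prP M0 hk; have M0' : 0 < INR M by apply: lt_0_INR; apply/ltP.
have E1 : W P xpredT = W P (fun p => covered s p x) + W P (fun p => ~~ covered s p x).
  by rewrite (W_split P xpredT (fun p => covered s p x)).
have := W_le_sum_ln (fun p => covered s p x) uP prP M0; rewrite -/(cov i P U s x) => h1.
lra.
Qed.

End GreedyStep.

(** [typical_hits] is applied to the set Y of points not yet covered enough, with [E x] the primes
    at which no chosen fibre covers x. It makes the sum of gains over pairs (x, y) in Y large, and
    averaging over y gives a value a = y_i. *)
Lemma greedy_step d eps k kap alpha c0 eta :
  (0 < d)%N -> 0 < eps -> 0 < kap -> 0 < alpha -> 0 < c0 -> 0 < eta ->
  exists2 c2, 0 < c2 & forall r : nat, (0 < r)%N ->
  exists N0, forall N, (N0 <= N)%N ->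
  forall P, adm d eps N P -> kap * ln (INR N) <= W P xpredT ->
  forall i (S U : {set point d N}), U \subset S ->
  c0 * Rpower (INR N) (INR k + eps) <= INR #|S| ->
  (forall p, p \in P -> INR #|red p @: S| <= alpha * INR p ^ k.+1) ->
  (forall x, x \in U ->
     INR #|fib i (x i) U| * Rpower (INR N) (eps / (2 * INR d)) <= c2 * eta / 2 * INR #|S|) ->
  forall s, eta * INR #|S| < INR #|[set x in U | rle (cov i P U s x) (INR r * ln (INR N))]| ->
  exists a, kap * c2 * eta / 16 * ln (INR N) * INR #|S| <=
    \rsum_(x in [set x in U | rle (cov i P U s x) (INR r * ln (INR N))]) gain i P U s a x.
Proof.
move=> d0 e0 kap0 al0 c00 eta0.
have [c2 c20 [N1 h1]] := @typical_hits d eps k (kap / 2) alpha (c0 * eta) d0 e0 ltac:(lra) al0 ltac:(nra).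
exists c2 => // r r0.
(* M is so large that a cover of at most r log N spends weight at most kap/4 log N above M; the
   primes up to M spend at most as much again for N large. Half of kap remains. *)
have [M hM] := INR_unbounded (4 * INR r / kap + 1).
have r0' : 1 <= INR r := leq_INR r0.
have kr : 0 < 4 * INR r / kap by apply: Rdiv_lt_0_compat; lra.
have M0 : (0 < M)%N by apply/ltP; apply: INR_lt => /=; lra.
have [N2 h2] := eventually_ln (4 * INR M / kap).
exists (maxn N1 N2) => N; rewrite geq_max => /andP[hN1 hN2] P aP hk i S U US hS hSp hfib s.
set Y := [set x in U | _] => hY.
have hL := h2 _ hN2; set L := ln (INR N) in hk hL *.
have YU : Y \subset U by apply/subsetP => x; rewrite inE => /andP[].
have uP := adm_uniq aP; have prP := adm_prime aP.
pose E (x : point d N) p := ~~ has (fun a => (a != x i) && hits i p U a x) s.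
have hL' : INR M <= kap / 4 * L.
  have -> : INR M = kap / 4 * (4 * INR M / kap) by field; lra.
  by apply: Rmult_le_compat_l; lra.
have M1 : 1 <= INR M := leq_INR M0.
have L0 : 0 < L.
  apply: (Rmult_lt_reg_l (kap / 4)); lra.
have hE x : x \in Y -> kap / 2 * L <= W P (E x).
  rewrite inE => /andP[_ /rleP]; rewrite -/L => hx.
  have := @W_uncovered d N i P U (kap * L) M s x uP prP M0 hk.
  have : cov i P U s x / INR M <= kap / 4 * L.
    apply: (Rmult_le_reg_r (INR M)); first lra.
    have -> : cov i P U s x / INR M * INR M = cov i P U s x by field; lra.
    apply: Rle_trans hx _.
    have -> : kap / 4 * L * INR M = kap / 4 * INR M * L by ring.
    apply: Rmult_le_compat_r; first lra.
    have -> : INR r = kap / 4 * (4 * INR r / kap) by field; lra.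
    by apply: Rmult_le_compat_l; lra.
  rewrite /E; lra.
have Yp p : p \in P -> INR #|red p @: Y| <= alpha * INR p ^ k.+1.
  move=> pP; apply: Rle_trans (hSp _ pP); apply: INR_cardm; apply: imsetS.
  exact: subset_trans YU US.
have hYc : c0 * eta * Rpower (INR N) (INR k + eps) <= INR #|Y|.
  apply: Rle_trans (Rlt_le _ _ hY).
  have -> : c0 * eta * Rpower (INR N) (INR k + eps) = eta * (c0 * Rpower (INR N) (INR k + eps)) by ring.
  by apply: Rmult_le_compat_l => //; lra.
have := h1 N hN1 P aP i Y E hYc Yp hE; rewrite -/L.
set G := [set x in Y | _] => hG.
set Q := Rpower _ _ in hfib.
have hx x : x \in G -> kap * c2 / 8 * L * INR #|Y| <= \rsum_(y in Y) gain i P U s (y i) x.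
  rewrite inE => /andP[xY /rleP hx].
  have -> : \rsum_(y in Y) gain i P U s (y i) x =
      \rsum_(p <- P | E x p) (ln (INR p) * INR #|[set y in Y | (y i != x i) && hits i p U (y i) x]|).
    rewrite /gain (eq_bigr (fun y : point d N => \rsum_(p <- P | E x p)
      (if (y i != x i) && hits i p U (y i) x then ln (INR p) else 0))).
      rewrite exchange_big /=; apply: eq_bigr => p _.
      by rewrite (rsum_indic _ (fun y : point d N => (y i != x i) && hits i p U (y i) x)) Rmult_comm.
    by move=> y _; rewrite -big_mkcondr.
  apply: (@Rle_trans _ (c2 / 2 * INR #|Y| * W P (fun p => E x p && rle (c2 * INR #|Y|)
        (INR p * INR #|[set y in Y | hits i p Y (y i) x]|)))).
    have -> : kap * c2 / 8 * L * INR #|Y| = c2 / 2 * INR #|Y| * (kap / 2 / 2 * L) by field.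
    apply: Rmult_le_compat_l => //.
    by apply: Rmult_le_pos; [lra|exact: pos_INR].
  rewrite /W big_distrr /= big_mkcondr /=; apply: rsum_le => p pP _.
  have p0 : (0 < p)%N by exact: prime_gt0 (prP _ pP).
  case: rleP => hp; last by apply: Rmult_le_pos; [exact: ln_ge0|exact: pos_INR].
  rewrite -(lwK p0).
  set n := INR #|[set y in Y | _ && _]|.
  have -> : INR p * lw p * n = INR p * n * lw p by ring.
  apply: Rmult_le_compat_r; first exact: lw_ge0.
  set H := INR #|[set y in Y | hits i p Y (y i) x]| in hp.
  (* Hits from the fibre through x give no gain. The hypothesis on fibres and p <= Q bound their
     number by half of c2 |Y| / p. *)
  have hn : H <= n + INR #|fib i (x i) U|.
    apply: Rle_trans (INR_cardU _ _); apply: INR_cardm; apply/subsetP => y.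
    rewrite inE => /andP[yY yh]; rewrite in_setU [X in X || _]inE [X in _ || X]inE.
    rewrite yY (subsetP YU _ yY) (hits_sub YU yh) andbT.
    by case: eqP.
  have hf : INR p * INR #|fib i (x i) U| <= c2 * eta / 2 * INR #|S|.
    apply: Rle_trans (hfib x (subsetP YU _ xY)); rewrite [X in _ <= X]Rmult_comm.
    by apply: Rmult_le_compat_r; [exact: pos_INR|exact: (adm_le aP pP)].
  have hp2 : INR p * H <= INR p * n + INR p * INR #|fib i (x i) U|.
    by rewrite -Rmult_plus_distr_l; apply: Rmult_le_compat_l => //; exact: pos_INR.
  have : c2 / 2 * (eta * INR #|S|) <= c2 / 2 * INR #|Y| by apply: Rmult_le_compat_l; lra.
  move=> hY2.
  have h3 : c2 * INR #|Y| <= INR p * n + INR p * INR #|fib i (x i) U| := Rle_trans _ _ _ hp hp2.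
  suff h4 : c2 / 2 * INR #|Y| <= INR p * n by [].
  lra.
have Y0 : 0 < INR #|Y| by apply: Rle_lt_trans hY; apply: Rmult_le_pos; [lra|exact: pos_INR].
have [||y yY hy] := @rsum_exists_ge _ Y (fun y => \rsum_(x in Y) gain i P U s (y i) x) (kap * c2 / 16 * L * INR #|Y|).
- by apply/ltP; apply: INR_lt.
- rewrite exchange_big /=.
  apply: (@Rle_trans _ (\rsum_(x in G) (kap * c2 / 8 * L * INR #|Y|))).
    rewrite rsum_const.
    have := Rmult_le_compat_r (kap * c2 / 16 * L * INR #|Y|) _ _ _ hG.
    move=> h3; apply: Rle_trans (h3 _) _; last by right; field.
    by apply: Rmult_le_pos; [|exact: pos_INR]; apply: Rmult_le_pos; [nra|lra].
  apply: (@Rle_trans _ (\rsum_(x in G) \rsum_(y in Y) gain i P U s (y i) x)).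
    by apply: rsumT_le => x; apply: hx.
  apply: rsum_sub => x _; last by rewrite inE => /andP[].
  by apply: rsumT_ge0 => y _; apply: gain_ge0.
exists (y i); apply: Rle_trans hy.
have -> : kap * c2 * eta / 16 * L * INR #|S| = kap * c2 / 16 * L * (eta * INR #|S|) by field.
by apply: Rmult_le_compat_l; [apply: Rmult_le_pos; [nra|lra]|left].
Qed.

(** A potential argument: each step raises [Psi] by at least g L |S|, while [Psi] never exceeds (r +
    1) L |S|, so O(r) steps suffice and [C2] does not depend on r. *)
Lemma greedy_cover d eps k kap alpha c0 eta :
  (0 < d)%N -> 0 < eps -> 0 < kap -> 0 < alpha -> 0 < c0 -> 0 < eta ->
  exists2 sigma, 0 < sigma & exists C2 : nat, forall r : nat, (0 < r)%N ->
  exists N0, forall N, (N0 <= N)%N ->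
  forall P, adm d eps N P -> kap * ln (INR N) <= W P xpredT ->
  forall i (S U : {set point d N}), U \subset S ->
  c0 * Rpower (INR N) (INR k + eps) <= INR #|S| ->
  (forall p, p \in P -> INR #|red p @: S| <= alpha * INR p ^ k.+1) ->
  (forall x, x \in U ->
     INR #|fib i (x i) U| * Rpower (INR N) (eps / (2 * INR d)) <= sigma * INR #|S|) ->
  exists2 s, (size s <= C2 * r)%N &
    INR #|[set x in U | rle (cov i P U s x) (INR r * ln (INR N))]| <= eta * INR #|S|.
Proof.
move=> d0 e0 kap0 al0 c00 eta0.
have [c2 c20 h] := @greedy_step d eps k kap alpha c0 eta d0 e0 kap0 al0 c00 eta0.
exists (c2 * eta / 2); first nra.
pose g := kap * c2 * eta / 16.
have g0 : 0 < g by rewrite /g; have := Rmult_lt_0_compat _ _ kap0 c20; nra.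
(* Then C2 r > 2 r / g >= (r + 1) / g, as r >= 1. *)
have [C2 hC2] := INR_unbounded (2 / g).
exists C2 => r r0; have [N1 h1] := h r r0.
exists (maxn N1 2) => N; rewrite geq_max => /andP[hN1 hN2] P aP hk i S U US hS hSp hfib.
have {h h1} step := h1 N hN1 P aP hk i S U US hS hSp hfib.
have L0 : 0 < ln (INR N).
  by rewrite -ln_1; apply: ln_increasing; [lra|apply: (lt_INR 1); apply/ltP].
set L := ln (INR N) in step L0 *.
have r1 : 1 <= INR r := leq_INR r0.
have S0 : 0 < INR #|S|.
  by apply: Rlt_le_trans hS; apply: Rmult_lt_0_compat => //; exact: exp_pos.
pose bad s := [set x in U | rle (cov i P U s x) (INR r * L)].
(* Truncation at (r + 1) L rather than r L loses no gain: a bad point is covered at most r L, and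
   one more fibre adds at most L. *)
pose Psi s := \rsum_(x in U) Rmin (cov i P U s x) ((INR r + 1) * L).
have key m : (exists2 s, (size s <= m)%N & INR #|bad s| <= eta * INR #|S|) \/
    (exists2 s, size s = m & INR m * (g * L * INR #|S|) <= Psi s).
  elim: m => [|m [[s sm hs]|[s sm hs]]].
  - right; exists [::] => //; rewrite /= Rmult_0_l; apply: rsumT_ge0 => x _.
    by apply: Rmin_glb; [exact: cov_ge0|apply: Rmult_le_pos; lra].
  - by left; exists s => //; apply: leq_trans sm _.
  case: (Rle_or_lt (INR #|bad s|) (eta * INR #|S|)) => hb.
    by left; exists s => //; rewrite sm.
  have [a ha] := step s hb.
  right; exists (a :: s); first by rewrite /= sm.
  rewrite S_INR Rmult_plus_distr_r Rmult_1_l.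
  apply: (@Rle_trans _ (Psi s + \rsum_(x in bad s) gain i P U s a x)).
    by apply: Rplus_le_compat.
  have -> : \rsum_(x in bad s) gain i P U s a x =
      \rsum_(x in U) (if rle (cov i P U s x) (INR r * L) then gain i P U s a x else 0).
    by rewrite -big_mkcondr; apply: eq_bigl => x; rewrite inE.
  rewrite -big_split /=; apply: rsumT_le => x xU; rewrite cov_cons.
  have g1 := gain_ge0 i P U s a x.
  have g2 := gain_le i U s a x (adm_uniq aP) (adm_prime aP).
  rewrite -/L in g2.
  case: rleP => hx.
    by rewrite !Rmin_left; lra.
  rewrite Rplus_0_r; apply: Rle_min_compat_r; lra.
case: (key (C2 * r)%N) => [//|[s _ hs]].
have up : Psi s <= INR #|S| * ((INR r + 1) * L).
  apply: (@Rle_trans _ (\rsum_(x in U) ((INR r + 1) * L))).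
    by apply: rsumT_le => x _; exact: Rmin_r.
  rewrite rsum_const; apply: Rmult_le_compat_r; last exact: INR_cardm.
  by apply: Rmult_le_pos; lra.
exfalso.
have h1 := Rle_trans _ _ _ hs up.
have SL : 0 < INR #|S| * L by apply: Rmult_lt_0_compat.
have h2 : INR (C2 * r) * g <= INR r + 1.
  apply: (Rmult_le_reg_r (INR #|S| * L)) => //; lra.
rewrite -multE mult_INR in h2.
have h3 : 2 < INR C2 * g.
  have -> : 2 = 2 / g * g by field; lra.
  by apply: Rmult_lt_compat_r.
have : 2 * INR r < INR C2 * g * INR r by apply: Rmult_lt_compat_r; lra.
lra.
Qed.

(* The only properties of a polynomial function that the argument uses. *)
Record tame d N (r : nat) (f : point d N -> int) : Prop := Tame {
  tame_mod : forall p (x y : point d N), red p x = red p y -> (p %| absz (f x - f y)%R)%N;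
  tame_le : forall x, (absz (f x) <= N ^ r)%N }.

Lemma tame_vanish d N (r : nat) (f : point d N -> int) (P : seq nat) i (U : {set point d N}) s x :
  uniq P -> (forall p, p \in P -> prime p) -> (0 < N)%N -> tame r f ->
  (forall u, u \in U -> u i \in s -> f u = 0%R) ->
  INR r * ln (INR N) < cov i P U s x -> f x = 0%R.
Proof.
move=> uP prP N0 [fm fl] fU hx; apply/eqP; apply/negPn/negP => fx0.
have fx1 : (0 < absz (f x))%N by rewrite absz_gt0.
have : cov i P U s x <= ln (INR (absz (f x))).
  apply: sum_ln_dvd => // p pP /hasP[a as_ /andP[_ /imsetP[u]]].
  rewrite inE => /andP[uU /eqP ua] xu.
  have fu : f u = 0%R by apply: fU; rewrite ?ua.
  by have := fm p x u xu; rewrite fu GRing.subr0.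
have : ln (INR (absz (f x))) <= INR r * ln (INR N).
  rewrite -ln_pow; last by apply: lt_0_INR; apply/ltP.
  apply: ln_le_mono; first by apply: lt_0_INR; apply/ltP.
  rewrite -pow_INR; apply: leq_INR; apply: leq_trans (fl x) _.
  by rewrite (_ : Nat.pow N r = (N ^ r)%N) //; elim: r {fl hx} => //= r ->; rewrite expnS.
lra.
Qed.

(** * Test sets by induction on the dimension *)

(** Take q > alpha points of S. For every p two of them agree modulo p, so p divides a nonzero
    coordinate difference of one of at most q^2 pairs, and the sum of log p over P is at most q^2
    log N. By [W_le_sum_ln], with M large against q^2 / kap, this contradicts the weight of P. *)
Lemma zero_dim d eps kap alpha : 0 < kap -> 0 < alpha ->
  exists q : nat, exists N0, forall N, (N0 <= N)%N ->
  forall P, adm d eps N P -> kap * ln (INR N) <= W P xpredT ->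
  forall S : {set point d N}, (forall p, p \in P -> INR #|red p @: S| <= alpha) ->
  (#|S| <= q)%N.
Proof.
move=> kap0 al0; have [q hq] := INR_unbounded alpha.
have [M hM] := INR_unbounded (2 * (INR q * INR q) / kap + 1).
have qq : 0 <= 2 * (INR q * INR q) / kap.
  by apply: Rle_mult_inv_pos => //; have := pos_INR q; nra.
have [N1 h1] := eventually_ln ((2 * INR M + 1) / kap).
have M0 : (0 < M)%N by apply/ltP; apply: INR_lt => /=; lra.
exists q, N1 => N hN P aP hk S hS.
have uP := adm_uniq aP; have prP := adm_prime aP.
set L := ln (INR N) in hk.
have hL : 2 * INR M + 1 <= kap * L.
  have -> : 2 * INR M + 1 = kap * ((2 * INR M + 1) / kap) by field; lra.
  by apply: Rmult_le_compat_l; [lra|exact: h1].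
rewrite leqNgt; apply/negP => Sq.
pose S0 := [set x in take q (enum S)].
have cS0 : #|S0| = q.
  rewrite /S0 cardsE (card_uniqP _) ?take_uniq ?enum_uniq // size_take -cardE.
  by rewrite Sq.
have S0S : S0 \subset S.
  by apply/subsetP => x; rewrite inE => /mem_take; rewrite mem_enum.
have coll p : p \in P -> exists x, [&& x \in S0 & [exists y in S0, (x != y) && (red p x == red p y)]].
  move=> pP; apply/existsP; apply: contraT; rewrite negb_exists => /forallP hn.
  have inj : {in S0 &, injective (red p)}.
    move=> x y xS yS xy; apply/eqP; apply: contraT => nxy.
    have := hn x; rewrite xS /= => /exists_inPn/(_ y yS).
    by rewrite nxy xy eqxx.
  have : INR #|S0| <= alpha.
    rewrite -(card_in_imset inj); apply: Rle_trans (hS _ pP).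
    by apply: INR_cardm; apply: imsetS.
  rewrite cS0; lra.
have up : \rsum_(p <- P) ln (INR p) <= INR q * (INR q * L).
  apply: (@Rle_trans _ (\rsum_(x in S0) \rsum_(y in S0) \rsum_(p <- P | (x != y) && (red p x == red p y)) ln (INR p))).
    rewrite (eq_bigr (fun x => \rsum_(p <- P) \rsum_(y in S0) if (x != y) && (red p x == red p y) then ln (INR p) else 0)).
      rewrite exchange_big /=; apply: rsum_le => p pP _.
      have [x /andP[xS /exists_inP[y yS xy]]] := coll p pP.
      rewrite (bigD1 x) //= (bigD1 y) //= xy.
      have h0 : forall z, 0 <= if z then ln (INR p) else 0.
        by case; [exact: ln_ge0|lra].
      apply: (@Rle_trans _ (ln (INR p) + 0 + 0)); first lra.
      apply: Rplus_le_compat; last first.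
        by apply: rsumT_ge0 => ? _; apply: rsumT_ge0 => ? _; apply: h0.
      by apply: Rplus_le_compat_l; apply: rsumT_ge0 => ? _; apply: h0.
    move=> x _; rewrite exchange_big /=; apply: eq_bigr => y _; exact: big_mkcond.
  rewrite -{1}cS0 -rsum_const; apply: rsumT_le => x _.
  rewrite -{1}cS0 -rsum_const; apply: rsumT_le => y _.
  have [->|nxy] := eqVneq x y; first by rewrite big_pred0 ?eqxx //; exact: ln_ge0.
  have /existsP[i hi] : [exists i, x i != y i].
    rewrite -negb_forall; apply: contraNN nxy => /forallP h.
    by apply/eqP/ffunP => i; apply/eqP.
  apply: (sum_ln_rmod uP prP hi) => p _ /= /eqP/ffunP/(_ i).
  by rewrite !redE.
have := W_le_sum_ln xpredT uP prP M0.
set T := \rsum_(p <- P) _ in up *; move=> h2.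
have M0' : 0 < INR M by apply: lt_0_INR; apply/ltP.
have hT : T / INR M <= kap / 2 * L.
  apply: (Rmult_le_reg_r (INR M)) => //.
  have -> : T / INR M * INR M = T by field; lra.
  have L0 : 0 <= L := ln_ge0 N.
  have h3 : 2 * (INR q * INR q) <= kap * INR M.
    have -> : 2 * (INR q * INR q) = kap * (2 * (INR q * INR q) / kap) by field; lra.
    by apply: Rmult_le_compat_l; lra.
  have := Rmult_le_compat_r _ _ _ L0 h3; lra.
have h4 : kap * L <= INR M + T / INR M := Rle_trans _ _ _ hk h2.
lra.
Qed.

Lemma card_has (I J : finType) (F : J -> {set I}) (s : seq J) n :
  (forall j, #|F j| <= n)%N -> (#|[set x | has (fun j => x \in F j) s]| <= size s * n)%N.
Proof.
move=> h; elim: s => [|j s IH] /=.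
  by rewrite (_ : [set _ | _] = set0) ?cards0 //; apply/setP => x; rewrite !inE.
rewrite mulSn; apply: leq_trans (leq_add (h j) IH).
apply: leq_trans (leq_card_setU _ _); apply: subset_leq_card.
by apply/subsetP => x; rewrite !inE.
Qed.

Definition heavy d N (S : {set point d N}) (i : 'I_d) (K : R) (k p : nat) :=
  [set b : 'I_N.+1 | ~~ rle (INR #|[set z in red p @: S | z i == b]|) (K * INR p ^ k)].

(** Markov's inequality: each heavy residue uses more than K p^k of the at most alpha p^(k+1)
    classes. *)
Lemma card_heavy d N (S : {set point d N}) i K k p alpha delta : (0 < p)%N ->
  0 < delta -> 0 < alpha -> K = alpha / delta ->
  INR #|red p @: S| <= alpha * INR p ^ k.+1 ->
  INR #|heavy S i K k p| <= delta * INR p.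
Proof.
move=> p0 del0 al0 EK h.
have p0' : 0 < INR p by apply: lt_0_INR; apply/ltP.
have pk : 0 < INR p ^ k by apply: pow_lt.
have K0 : 0 < K by rewrite EK; apply: Rdiv_lt_0_compat.
have h1 : INR #|heavy S i K k p| * (K * INR p ^ k) <= INR #|red p @: S|.
  rewrite -rsum_const [in X in _ <= X]INR_card.
  rewrite (partition_big (fun z : point d N => z i) xpredT) //=.
  apply: (@Rle_trans _ (\rsum_(b in heavy S i K k p) INR #|[set z in red p @: S | z i == b]|)).
    by apply: rsumT_le => b; rewrite inE => /rleNP; lra.
  apply: (@Rle_trans _ (\rsum_(b | true) INR #|[set z in red p @: S | z i == b]|)).
    by apply: rsum_sub => // b _; apply: pos_INR.
  apply: rsumT_le => b _; rewrite INR_card; right; apply: eq_bigl => z.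
  by rewrite inE.
apply: (Rmult_le_reg_r (K * INR p ^ k)); first by apply: Rmult_lt_0_compat.
have -> : delta * INR p * (K * INR p ^ k) = alpha * INR p ^ k.+1.
  by rewrite EK /=; field; lra.
exact: Rle_trans h1 h.
Qed.

(* Coordinate values a for which either the fibre of S over a mod p is too large
   for many p, or the fibre of S over a carries too much of S. *)
Definition exceptional d N (P : seq nat) (S : {set point d N}) (i : 'I_d) (K lam sQ : R) k :=
  [set a : 'I_N.+1 |
    rle (lam * ln (INR N)) (W P (fun p => rmod p a \in heavy S i K k p))
    || ~~ rle (INR #|fib i a S| * sQ) (INR #|S|)].

(** A value of the first kind lies, for many p, in one of at most delta p heavy residues, so
    [larger_sieve] applies; those of the second kind number at most sQ because fibres are
    disjoint. *)
Lemma card_exceptional d eps N P (S : {set point d N}) i k alpha lam delta sQ :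
  (0 < d)%N -> 0 < eps -> (1 < N)%N -> adm d eps N P -> 0 < lam -> 0 < delta ->
  2 * delta <= lam * lam -> 0 < alpha -> 0 < sQ -> (0 < #|S|)%N ->
  (forall p, p \in P -> INR #|red p @: S| <= alpha * INR p ^ k.+1) ->
  INR #|exceptional P S i (alpha / delta) lam sQ k| <=
  eps / (2 * INR d) * Rpower (INR N) (eps / (2 * INR d)) + sQ.
Proof.
move=> d0 e0 N1 aP lam0 del0 hld al0 sQ0 S0 hS.
pose X1 := [set a : 'I_N.+1 | rle (lam * ln (INR N)) (W P (fun p => rmod p a \in heavy S i (alpha / delta) k p))].
pose X2 := [set a : 'I_N.+1 | ~~ rle (INR #|fib i a S| * sQ) (INR #|S|)].
apply: (@Rle_trans _ (INR #|X1| + INR #|X2|)).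
  apply: Rle_trans (INR_cardU _ _); apply: INR_cardm; apply/subsetP => a.
  by rewrite !inE.
apply: Rplus_le_compat.
  apply: (@larger_sieve d eps N P X1 (fun a p => rmod p a \in heavy S i (alpha / delta) k p) lam delta) => //.
    by move=> a; rewrite inE => /rleP.
  move=> p pP; apply: Rle_trans (@card_heavy d N S i (alpha / delta) k p alpha delta (adm_gt0 aP pP) del0 al0 erefl (hS _ pP)).
  by apply: INR_cardm; apply/subsetP => b /imsetP[a]; rewrite inE => /andP[_ h] ->.
have S0' : 0 < INR #|S| by apply: lt_0_INR; apply/ltP.
have h1 : INR #|X2| * (INR #|S| / sQ) <= INR #|S|.
  rewrite -rsum_const [in X in _ <= X]INR_card.
  rewrite [X in _ <= X](partition_big (fun z : point d N => z i) xpredT) //=.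
  apply: (@Rle_trans _ (\rsum_(a in X2) INR #|fib i a S|)).
    apply: rsumT_le => a; rewrite inE => /rleNP h.
    apply: (Rmult_le_reg_r sQ) => //.
    have -> : INR #|S| / sQ * sQ = INR #|S| by field; lra.
    by left.
  apply: (@Rle_trans _ (\rsum_(a | true) INR #|fib i a S|)).
    by apply: rsum_sub => // a _; apply: pos_INR.
  apply: rsumT_le => a _; rewrite INR_card; right; apply: eq_bigl => z.
  by rewrite inE.
apply: (Rmult_le_reg_r (INR #|S| / sQ)); first by apply: Rdiv_lt_0_compat.
apply: Rle_trans h1 _; right; field; lra.
Qed.

(* Each fibre step costs a factor O(r) of test points, hence r^k in dimension k. *)
Lemma characteristic_set d eps : (0 < d)%N -> 0 < eps ->
  forall k kap alpha c0 eta, 0 < kap -> 0 < alpha -> 0 < c0 -> 0 < eta ->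
  exists c : nat, forall r : nat, (0 < r)%N ->
  exists N0, forall N, (N0 <= N)%N ->
  forall P, adm d eps N P -> kap * ln (INR N) <= W P xpredT ->
  forall S : {set point d N},
  c0 * Rpower (INR N) (INR k - 1 + eps) <= INR #|S| ->
  (forall p, p \in P -> INR #|red p @: S| <= alpha * INR p ^ k) ->
  exists A B : {set point d N}, [/\ (#|A| <= c * r ^ k)%N, B \subset S,
    INR #|S :\: B| <= eta * INR #|S| &
    forall f, tame r f -> (forall x, x \in A -> f x = 0%R) ->
      forall x, x \in B -> f x = 0%R].
Proof.
move=> d0 e0; have d0' : 0 < INR d by apply: lt_0_INR; apply/ltP.
elim=> [|k IH] kap alpha c0 eta kap0 al0 c00 eta0.
  have [q [N0 h]] := @zero_dim d eps kap alpha kap0 al0.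
  exists q => r r0; exists N0 => N hN P aP hk S hS hSp.
  exists S, S; split => //; last first.
    rewrite setDv cards0; apply: Rmult_le_pos; [lra|exact: pos_INR].
  rewrite expn0 muln1; apply: (h N hN P aP hk S) => p pP.
  by have := hSp p pP; rewrite /= Rmult_1_r.
(* The discarded points form one box and three sets for each of the d coordinates, each of size at
   most [eta1] times |S|. *)
pose eta1 := eta / (3 * INR d + 1).
have eta10 : 0 < eta1 by apply: Rdiv_lt_0_compat; lra.
pose delta := kap * kap / 8.
have del0 : 0 < delta by rewrite /delta; nra.
have [sg sg0 [C2 hC2]] := @greedy_cover d eps k kap alpha c0 eta1 d0 e0 kap0 al0 c00 eta10.
have ad0 : 0 < alpha / delta by apply: Rdiv_lt_0_compat.
(* For a value a that is not exceptional, the primes at which a is not heavy still weigh kap/2 log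
   N, and at these the fibre has at most (alpha/delta) p^k classes. *)
have [ck hck] := IH (kap / 2) (alpha / delta) (c0 * eta1 / 2) eta1 ltac:(lra) ad0 ltac:(nra) eta10.
exists (d * (C2 * ck))%N => r r0.
have [N1 h1] := hC2 r r0; have [N2 h2] := hck r r0.
pose th := eps / (2 * INR d).
have th0 : 0 < th by apply: Rdiv_lt_0_compat; lra.
have ce0 : 0 < c0 * eta1 by apply: Rmult_lt_0_compat.
have [N3 h3] := @eventually_half ((th + / sg) ^ d) (c0 * eta1) eps k ce0 e0.
exists (maxn (maxn N1 N2) (maxn N3 2)) => N; rewrite !geq_max.
move=> /andP[/andP[hN1 hN2] /andP[hN3 hN4]] P aP hk S hS' hSp.
have hS : c0 * Rpower (INR N) (INR k + eps) <= INR #|S|.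
  by move: hS'; rewrite S_INR (_ : INR k + 1 - 1 + eps = INR k + eps) //; ring.
have S0 : 0 < INR #|S|.
  by apply: Rlt_le_trans hS; apply: Rmult_lt_0_compat => //; exact: exp_pos.
have Sn0 : (0 < #|S|)%N by apply/ltP; apply: INR_lt.
pose Q := Rpower (INR N) th.
have Q0 : 0 < Q := exp_pos _.
(* A fibre with more than sg |S| / Q points makes its value exceptional, because [greedy_cover]
   needs fibres of at most that size. *)
pose sQ := / sg * Q.
have sQ0 : 0 < sQ by apply: Rmult_lt_0_compat => //; apply: Rinv_0_lt_compat.
pose X i := exceptional P S i (alpha / delta) (kap / 2) sQ k.
pose t := c0 * eta1 / 2 * Rpower (INR N) (INR k - 1 + eps).
pose good (ia : 'I_d * 'I_N.+1) := (ia.2 \notin X ia.1) && rle t (INR #|fib ia.1 ia.2 S|).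
(* A value that is exceptional or has a small fibre gets empty sets, so that the pair of test set
   and vanishing set is defined for every value. *)
have hfib (ia : 'I_d * 'I_N.+1) : exists u : {set point d N} * {set point d N},
    [/\ (#|u.1| <= ck * r ^ k)%N, u.2 \subset fib ia.1 ia.2 S,
      if good ia then INR #|fib ia.1 ia.2 S :\: u.2| <= eta1 * INR #|fib ia.1 ia.2 S|
        else u.2 = set0 &
      forall f, tame r f -> (forall x, x \in u.1 -> f x = 0%R) ->
        forall x, x \in u.2 -> f x = 0%R].
  case: ia => i a /=; case: (boolP (good (i, a))) => [/andP[/= aX /rleP ha]|_]; last first.
    exists (set0, set0); rewrite cards0 sub0set; split=> // f _ _ x; by rewrite inE.
  move: aX; rewrite inE negb_or => /andP[/rleNP aX _].
  pose Pa := [seq p <- P | rmod p a \notin heavy S i (alpha / delta) k p].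
  have hka : kap / 2 * ln (INR N) <= W Pa xpredT.
    rewrite W_filter (_ : W P _ = W P (fun p => rmod p a \notin heavy S i (alpha / delta) k p)); last first.
      by apply: eq_bigl => p; rewrite andbT.
    pose F p := rmod p a \in heavy S i (alpha / delta) k p.
    have hF : W P F < kap / 2 * ln (INR N) := aX.
    have hW : W P xpredT = W P F + W P (fun p => ~~ F p) := W_split P xpredT F.
    suff : kap / 2 * ln (INR N) <= W P (fun p => ~~ F p) by [].
    lra.
  have [|A [B [hA hB hSB hf]]] := h2 N hN2 Pa (adm_filter _ aP) hka (fib i a S) ha.
    move=> p; rewrite mem_filter => /andP[hh pP]; move: hh; rewrite inE negbK => /rleP h.
    apply: Rle_trans h; apply: INR_cardm; apply/subsetP => z /imsetP[x /[!inE] /andP[xS /eqP xa] ->]; rewrite redE xa eqxx andbT.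
    exact: imset_f.
  by exists (A, B).
have [u hu] := fin_all_exists hfib.
(* Over all values of coordinate i, the points where vanishing on the test set of their fibre forces
   f to vanish. *)
pose U i := [set x in S | x \in (u (i, x i)).2].
have US i : U i \subset S by apply/subsetP => x; rewrite inE => /andP[].
have fibU i a : fib i a (U i) \subset (u (i, a)).2.
  by apply/subsetP => x; rewrite !inE => /andP[/andP[_ h] /eqP <-].
have Ugood i x : x \in U i -> good (i, x i).
  rewrite inE => /andP[_]; have [_ _ + _] := hu (i, x i).
  by case: (good (i, x i)) => // ->; rewrite inE.
have hcov i : exists s : seq 'I_N.+1, (size s <= C2 * r)%N /\
    INR #|[set x in U i | rle (cov i P (U i) s x) (INR r * ln (INR N))]| <= eta1 * INR #|S|.
  have [|s hs hs2] := h1 N hN1 P aP hk i S (U i) (US i) hS hSp; last by exists s.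
  move=> x xU; have /andP[/= hx _] := Ugood _ _ xU.
  move: hx; rewrite inE negb_or negbK => /andP[_ /rleP hx].
  apply: (@Rle_trans _ (INR #|fib i (x i) S| * Q)).
    apply: Rmult_le_compat_r; first exact: Rlt_le Q0.
    by apply: INR_cardm; apply/subsetP => y; rewrite !inE => /andP[/andP[-> _] ->].
  have -> : INR #|fib i (x i) S| * Q = sg * (INR #|fib i (x i) S| * sQ).
    by rewrite /sQ; field; lra.
  by apply: Rmult_le_compat_l; [lra|exact: hx].
have [s hs] := fin_all_exists hcov.
pose A i := [set x | has (fun a => x \in (u (i, a)).1) (s i)].
pose V i := [set x in U i | ~~ rle (cov i P (U i) (s i) x) (INR r * ln (INR N))].
exists (\bigcup_i A i), (\bigcup_i V i); split.
- apply: (@leq_trans (d * (C2 * r * (ck * r ^ k)))); last first.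
    by rewrite expnS; lia.
  apply: (@leq_trans (\sum_(i < d) (C2 * r * (ck * r ^ k)))); last first.
    by rewrite big_const iter_addn_0 card_ord mulnC.
  apply: (big_ind2 (fun (A : {set point d N}) n => #|A| <= n)%N) => [|A1 n1 A2 n2 ? ?|i _].
  + by rewrite cards0.
  + by apply: leq_trans (leq_card_setU _ _) _; apply: leq_add.
  have [hs1 _] := hs i.
  have hA1 : (#|A i| <= size (s i) * (ck * r ^ k))%N.
    by apply: card_has => a; case: (hu (i, a)).
  by apply: leq_trans hA1 _; rewrite leq_mul2r hs1 orbT.
- by apply/bigcupsP => i _; apply/subsetP => x; rewrite inE => /andP[/(subsetP (US i))].
(* A point of S is lost if all its coordinates are exceptional, or else if along some coordinate it
   lies on a small fibre, is lost inside its good fibre, or is covered too little. *)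
- pose box := [set x : point d N | [forall i, x i \in X i]].
  pose F1 i := [set x in S | ~~ rle t (INR #|fib i (x i) S|)].
  pose F2 i := [set x in S | good (i, x i) && (x \notin (u (i, x i)).2)].
  pose F3 i := [set x in U i | rle (cov i P (U i) (s i) x) (INR r * ln (INR N))].
  have hb : INR #|box| <= eta1 * INR #|S|.
    apply: (@Rle_trans _ (((th + / sg) * Q) ^ d)).
      apply: card_box.
        by apply: Rmult_le_pos; [have := Rinv_0_lt_compat _ sg0; lra|lra].
      move=> i; apply: Rle_trans (card_exceptional i d0 e0 hN4 aP _ del0 _ al0 sQ0 Sn0 hSp) _; [lra|rewrite /delta; lra|].
      by right; rewrite /sQ -/th -/Q; ring.
    rewrite Rpow_mult_distr /Q /th Rpower_theta // -/th.
    apply: Rle_trans (h3 N hN3) _.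
    have -> : c0 * eta1 * Rpower (INR N) (INR k + eps) = eta1 * (c0 * Rpower (INR N) (INR k + eps)) by ring.
    by apply: Rmult_le_compat_l; lra.
  have t0 : 0 < t by apply: Rmult_lt_0_compat; [lra|exact: exp_pos].
  have hF1 i : INR #|F1 i| <= eta1 * INR #|S|.
    apply: Rle_trans (card_small_fibers i S (Rlt_le _ _ t0)) _.
    have n1 : 1 <= INR N by apply: (leq_INR (m := 1)); apply: ltnW.
    apply: (@Rle_trans _ (2 * (INR N * t))).
      rewrite -Rmult_assoc; apply: Rmult_le_compat_r; first lra.
      rewrite S_INR; lra.
    have -> : 2 * (INR N * t) = eta1 * (c0 * Rpower (INR N) (INR k + eps)).
      rewrite /t -(@Rpower_INR_S N (INR k - 1 + eps) (INR k + eps)) //; [field|exact: ltnW|ring].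
    by apply: Rmult_le_compat_l; lra.
  have hF2 i : INR #|F2 i| <= eta1 * INR #|S|.
    rewrite !INR_card (partition_big (fun z : point d N => z i) xpredT) //=.
    rewrite [X in _ <= _ * X](partition_big (fun z : point d N => z i) xpredT) //= big_distrr /=.
    apply: rsumT_le => a _.
    have E2 : \rsum_(x | (x \in S) && (x i == a)) 1 = INR #|fib i a S|.
      by rewrite INR_card; apply: eq_bigl => x; rewrite inE.
    rewrite E2.
    have [_ _ + _] := hu (i, a); case: (boolP (good (i, a))) => hg hh.
      apply: Rle_trans hh; rewrite INR_card; right; apply: eq_bigl => x.
      rewrite !inE; case: eqP => [->|_]; last by rewrite !andbF.
      by rewrite hg !andbT andbC.
    rewrite big_pred0; first by apply: Rmult_le_pos; [lra|exact: pos_INR].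
    move=> x; rewrite !inE; case: eqP => [->|_]; last by rewrite !andbF.
    by rewrite (negbTE hg) !andbF.
  have hF3 i : INR #|F3 i| <= eta1 * INR #|S| by case: (hs i).
  pose F i := F1 i :|: (F2 i :|: F3 i).
  have -> : eta * INR #|S| = eta1 * INR #|S| + INR #|'I_d| * (3 * (eta1 * INR #|S|)).
    by rewrite card_ord /eta1; field; lra.
  apply: (union_bound (B := box) (F := F)) => // [x|i]; last first.
    have -> : 3 * (eta1 * INR #|S|) = eta1 * INR #|S| + (eta1 * INR #|S| + eta1 * INR #|S|) by ring.
    apply: Rle_trans (INR_cardU _ _) _; apply: Rplus_le_compat; first exact: hF1.
    by apply: Rle_trans (INR_cardU _ _) _; apply: Rplus_le_compat; [exact: hF2|exact: hF3].
  rewrite inE => /andP[xV xS].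
  case: (boolP (x \in box)); first by left.
  rewrite inE => /forallPn[i xX]; right; exists i.
  rewrite in_setU; apply/orP; case: (boolP (x \in F1 i)) => xF1; first by left.
  right; rewrite in_setU; apply/orP.
  have g1 : good (i, x i).
    by rewrite /good /= xX /=; move: xF1; rewrite inE xS /= negbK.
  case: (boolP (x \in (u (i, x i)).2)) => xu; last by left; rewrite inE xS g1.
  have xU : x \in U i by rewrite inE xS.
  right; rewrite inE xU /=; apply: contraT => hx.
  case/negP: xV; apply/bigcupP; exists i => //.
  by rewrite inE xU.
move=> f ft fA x /bigcupP[i _]; rewrite inE => /andP[xU /rleNP hx].
apply: (@tame_vanish d N r f P i (U i) (s i) x (adm_uniq aP) (adm_prime aP) (ltnW hN4) ft _ hx).
move=> y yU ys; have [_ _ _ h] := hu (i, y i).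
apply: (h f ft).
  move=> z hz; apply: fA; apply/bigcupP; exists i => //.
  by rewrite inE; apply/hasP; exists (y i).
by apply: (subsetP (fibU i (y i))); rewrite inE yU eqxx.
Qed.

(** * Integer polynomials and the pigeonhole argument *)

Section Siegel.
Variables d N : nat.
Implicit Types x : point d N.

Lemma evalpt_mod (f : {mpoly int[d]}) p x y : red p x = red p y ->
  (p %| absz (evalpt f x - evalpt f y)%R)%N.
Proof.
move=> h; rewrite -(absz_nat p) -dvdzE /evalpt !mevalE -GRing.sumrB.
have xy i : (Posz p %| (Posz (x i) - Posz (y i))%R)%Z.
  rewrite -eqz_mod_dvd; apply/eqP; rewrite !modz_nat; congr Posz.
  by rewrite -!rmodE -!redE h.
apply: (big_ind (fun z => (Posz p %| z)%Z)) => [|a b|m _]; rewrite ?dvdz0 //.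
  by move=> ? ?; apply: GRing.rpredD.
rewrite -GRing.mulrBr; apply: dvdz_mull.
apply: (big_ind2 (fun a b => (Posz p %| (a - b)%R)%Z)) => [|a b a' b' h1 h2|i _].
- by rewrite GRing.subrr dvdz0.
- have -> : (a * a' - b * b' = a * (a' - b') + (a - b) * b')%R.
    by rewrite GRing.mulrBr GRing.mulrBl GRing.addrA GRing.subrK.
  by apply: GRing.rpredD; [apply: dvdz_mull|apply: dvdz_mulr].
by rewrite GRing.subrXX; apply: dvdz_mulr.
Qed.

Variable s : nat.
Notation J := {ffun 'I_d -> 'I_s.+1}.

(** Degrees are bounded in each variable separately: this gives exactly (s+1)^d monomials, of total
    degree at most d s. *)
Definition monom (j : J) : 'X_{1..d} := [multinom (j i : nat) | i < d].

Lemma monom_inj : injective monom.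
Proof.
move=> j1 j2 /mnmP h; apply/ffunP => i; apply/val_inj.
by have := h i; rewrite !mnmE.
Qed.

Definition boxpoly (e : J -> int) : {mpoly int[d]} := (\sum_j e j *: 'X_[monom j])%R.

Lemma mcoeff_boxpoly e j : ((boxpoly e)@_(monom j))%R = e j.
Proof.
rewrite /boxpoly GRing.raddf_sum /= (bigD1 j) //= mcoeffZ mcoeffX eqxx GRing.mulr1.
rewrite big1 ?GRing.addr0 // => j' /negbTE jj'; rewrite mcoeffZ mcoeffX.
by rewrite (inj_eq monom_inj) jj' GRing.mulr0.
Qed.

Lemma mcoeff_boxpoly_le e T m : (forall j, absz (e j) <= T)%N ->
  (absz ((boxpoly e)@_m)%R <= T)%N.
Proof.
move=> he; case: (pickP (fun j => monom j == m)) => [j /eqP <-|h].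
  by rewrite mcoeff_boxpoly.
rewrite /boxpoly GRing.raddf_sum /= big1 // => j _.
by rewrite mcoeffZ mcoeffX h GRing.mulr0.
Qed.

Lemma msize_boxpoly e : (msize (boxpoly e) <= (d * s).+1)%N.
Proof.
apply: leq_trans (msize_sum _ _ _) _; apply/bigmax_leqP => j _.
apply: leq_trans (msizeZ_le _ _) _; rewrite msizeX ltnS mdegE.
rewrite -[X in (X * s)%N]card_ord mulnC -iter_addn_0 -big_const.
by apply: leq_sum => i _; rewrite mnmE -ltnS.
Qed.

(** Values for nonnegative coefficients, which range over an initial segment of the naturals as the
    pigeonhole needs; the final polynomial is a difference of two such. *)
Definition nval (c : J -> nat) x : nat := (\sum_j c j * \prod_i (x i) ^ (j i))%N.

Lemma evalpt_boxpolyB (c c' : J -> nat) x :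
  evalpt (boxpoly (fun j => Posz (c j) - Posz (c' j))%R) x = (Posz (nval c x) - Posz (nval c' x))%R.
Proof.
have nvalZ (a : J -> nat) : Posz (nval a x) = (\sum_j Posz (a j) * \prod_i (Posz (x i)) ^+ (j i))%R.
  rewrite /nval (big_morph Posz PoszD (erefl _)); apply: eq_bigr => j _.
  rewrite PoszM; congr (_ * _)%R; rewrite (big_morph Posz PoszM (erefl _)).
  by apply: eq_bigr => i _; rewrite -!natz GRing.natrX.
rewrite !nvalZ -GRing.sumrB /evalpt /boxpoly GRing.raddf_sum /=.
apply: eq_bigr => j _; rewrite mevalZ mevalX GRing.mulrBl.
by congr (_ * _ - _ * _)%R; apply: eq_bigr => i _; rewrite mnmE.
Qed.

Lemma nval_le (c : J -> nat) T x : (0 < N)%N -> (forall j, c j <= T)%N ->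
  (nval c x <= s.+1 ^ d * (T * N ^ (d * s)))%N.
Proof.
move=> N0 hc; have -> : (s.+1 ^ d = #|{: J}|)%N by rewrite card_ffun !card_ord.
rewrite -sum_nat_const; apply: leq_sum => j _; apply: leq_mul => //.
have -> : (N ^ (d * s) = \prod_(i < d) N ^ s)%N.
  by rewrite prod_nat_const card_ord mulnC expnM.
apply: leq_prod => i _.
apply: (@leq_trans (N ^ j i)); last by apply: leq_pexp2l => //; rewrite -ltnS.
by case: (nat_of_ord (j i)) => // m; rewrite leq_exp2r // -ltnS.
Qed.

(* Pigeonhole on the values of the box polynomials with coefficients in [0,T]. *)
Lemma siegel (A : {set point d N}) : (0 < N)%N -> (2 * #|A| <= s.+1 ^ d)%N ->
  (2 * s.+1 ^ d <= N)%N ->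
  exists f : {mpoly int[d]}, [/\ f != 0%R, (msize f <= (d * s).+1)%N,
    forall m, (absz (f@_m)%R <= N ^ (d * s).+1)%N,
    forall x, x \in A -> evalpt f x = 0%R &
    forall x, (absz (evalpt f x) <= N ^ (2 * (d * s).+1))%N].
Proof.
move=> N0 hA hN; set T := (N ^ (d * s).+1)%N.
have T0 : (0 < T)%N by rewrite expn_gt0 N0.
pose V := (s.+1 ^ d * (T * N ^ (d * s)))%N.
(* Here N >= 2 (s+1)^d enters: T^2 = T N^(ds) N is at least twice the bound V on the values. *)
have VT : (V.+1 <= T * T)%N.
  apply: (@leq_trans (2 * V)).
    have : (0 < V)%N by rewrite !muln_gt0 !expn_gt0 N0.
    lia.
  have -> : (2 * V = T * N ^ (d * s) * (2 * s.+1 ^ d))%N by rewrite /V; lia.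
  have -> : (T * T = T * N ^ (d * s) * N)%N by rewrite {2}/T expnS; lia.
  by rewrite leq_mul.
pose nv (c : {ffun J -> 'I_T.+1}) x := nval (fun j => c j : nat) x.
have nvV c x : (nv c x <= V)%N by apply: nval_le => // j; rewrite -ltnS.
pose F (c : {ffun J -> 'I_T.+1}) : {ffun {x | x \in A} -> 'I_V.+1} :=
  [ffun x => inord (nv c (val x))].
have : ~~ injectiveb F.
  apply/injectiveP => /leq_card; rewrite !card_ffun !card_ord card_sig.
  rewrite leqNgt => /negP; apply.
  (* (V+1)^|A| <= T^(2|A|) <= T^((s+1)^d) < (T+1)^((s+1)^d): there are more coefficient vectors than
     value vectors. *)
  apply: (@leq_ltn_trans ((T * T) ^ #|A|)).
    rewrite (eq_card (B := mem A)) //.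
    by case: #|A| => // a; rewrite leq_exp2r.
  rewrite mulnn -expnM; apply: (@leq_ltn_trans (T ^ (s.+1 ^ d))).
    exact: leq_pexp2l.
  by rewrite ltn_exp2r ?expn_gt0.
case/injectivePn => c [c' cc' Fcc'].
pose e j := (Posz (c j) - Posz (c' j))%R.
have ev x : evalpt (boxpoly e) x = (Posz (nv c x) - Posz (nv c' x))%R.
  exact: evalpt_boxpolyB.
have absB (a b M : nat) : (a <= M)%N -> (b <= M)%N -> (absz (Posz a - Posz b)%R <= M)%N by lia.
exists (boxpoly e); split.
- apply: contraNneq cc' => f0; apply/eqP/ffunP => j; apply/val_inj => /=.
  have := mcoeff_boxpoly e j; rewrite f0 mcoeff0 /e => /eqP.
  by rewrite eq_sym GRing.subr_eq0 => /eqP [].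
- exact: msize_boxpoly.
- by move=> m; apply: mcoeff_boxpoly_le => j; apply: absB; rewrite -ltnS.
- move=> x xA; rewrite ev; apply/eqP; rewrite GRing.subr_eq0; apply/eqP; congr Posz.
  move/ffunP/(_ (exist _ x xA))/(congr1 val): Fcc'.
  by rewrite !ffunE /= !inordK ?ltnS.
move=> x; rewrite ev; apply: leq_trans (absB _ _ _ (nvV c x) (nvV c' x)) _.
by rewrite mulnC expnM -mulnn -/T; lia.
Qed.

End Siegel.

(** * Small N: polynomials vanishing on the whole box *)

Definition vanishing d N (C : nat) := exists f : {mpoly int[d]},
  [/\ f != 0%R, (msize f <= C.+1)%N, forall m, (absz (f@_m)%R <= N ^ C)%N &
    forall x : point d N, evalpt f x = 0%R].

Lemma vanishing_mono d N C C' : (0 < N)%N -> (C <= C')%N -> vanishing d N C -> vanishing d N C'.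
Proof.
move=> N0 CC [f [f0 fs fm fx]]; exists f; split=> //; first exact: leq_trans fs _.
by move=> m; apply: leq_trans (fm m) _; apply: leq_pexp2l.
Qed.

(** The product of x_0 - j over j = 0, ..., N vanishes on the box. For N >= 2 any fixed coefficients
    are below N^C for C large. *)
Lemma vanishing_exists d N : (0 < d)%N -> (0 < N)%N -> exists C, vanishing d N C.
Proof.
move=> d0 N0; pose i := Ordinal d0.
case: (ltngtP N 1) => [|N1|N1]; first by lia.
  pose g j : {mpoly int[d]} := ('X_i - (Posz j)%:MP)%R.
  pose f : {mpoly int[d]} := (\prod_(j < N.+1) g j)%R.
  have f0 : f != 0%R.
    apply/GRing.prodf_neq0 => j _; apply/eqP => /mpolyP/(_ U_(i)%MM).
    rewrite mcoeffB mcoeffXU eqxx mcoeffC mcoeff0 -mdeg_eq0 mdeg1 /=.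
    by rewrite GRing.mulr0 GRing.subr0.
  pose b := (\sum_(m <- msupp f) absz (f@_m)%R)%N.
  exists (b + msize f)%N, f; split=> //; first by lia.
    move=> m; apply: (@leq_trans b).
      case: (boolP (m \in msupp f)) => hm; last by rewrite memN_msupp_eq0.
      by rewrite /b (big_rem m hm) leq_addr.
    apply: (@leq_trans (N ^ b)); first exact: ltnW (ltn_expl _ N1).
    by apply: leq_pexp2l => //; rewrite leq_addr.
  move=> x; rewrite /evalpt /f GRing.rmorph_prod /=; apply/eqP/GRing.prodf_eq0.
  by exists (x i) => //; rewrite /g mevalB mevalXU mevalC GRing.subrr.
(* For N = 1 the bound N^C is 1 whatever C is, so a polynomial with coefficients in {-1, 0, 1} is
   exhibited. *)
rewrite N1; exists 2%N, ('X_[U_(i) *+ 2] - 'X_[U_(i)])%R; split.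
- apply/eqP => /mpolyP/(_ U_(i)%MM); rewrite mcoeffB !mcoeffX eqxx mcoeff0.
  case: eqP => [/(congr1 mdeg)|_]; first by rewrite mdegMn mdeg1.
  by [].
- apply: leq_trans (msizeD_le _ _) _; rewrite msizeN !msizeX mdegMn !mdeg1.
  by [].
- by move=> m; rewrite mcoeffB !mcoeffX; case: (_ == m); case: (_ == m).
move=> x; rewrite /evalpt mevalB -mpolyXn GRing.rmorphXn /= mevalXU.
by case: (x i) => [[|[|?]]].
Qed.

Lemma vanishing_upto d M : (0 < d)%N ->
  exists C, forall N, (0 < N)%N -> (N < M)%N -> vanishing d N C.
Proof.
move=> d0; elim: M => [|M [C hC]]; first by exists 0%N.
have [M0|M0] := posnP M; first by exists 0%N => N; rewrite M0; lia.
have [C' hC'] := vanishing_exists d0 M0.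
exists (maxn C C') => N N0; rewrite ltnS leq_eqVlt => /orP[/eqP->|NM].
  by apply: vanishing_mono hC' => //; apply: leq_maxr.
by apply: vanishing_mono (hC N N0 NM) => //; apply: leq_maxl.
Qed.

(** * Choice of the constants and conclusion *)

(** Primes are dropped while the rest still weighs c; as each weight is at most 1, the overshoot is
    at most 1. This provides [adm_W]. *)
Lemma trim_weight (P : seq nat) (c : R) : 0 <= c -> c <= W P xpredT ->
  exists2 P', subseq P' P & c <= W P' xpredT <= c + 1.
Proof.
move=> c0; elim: P => [h|p P IH].
  by exists [::] => //; move: h; rewrite /W big_nil; lra.
have E : W (p :: P) xpredT = lw p + W P xpredT by rewrite /W big_cons.
move=> h; case: (Rle_lt_dec c (W P xpredT)) => hc.
  by have [P' sP hP] := IH hc; exists P' => //; apply: subseq_trans sP (subseq_cons _ _).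
exists (p :: P); first exact: subseq_refl.
have := lw_le1 p; lra.
Qed.

Theorem theorem2p4 (d k : nat) (eps eta kappa alpha c0 : R) :
  (k < d)%N ->
  0 < eps -> 0 < eta -> 0 < kappa -> 0 < alpha -> 0 < c0 ->
  exists C : nat,
  forall (N : nat), (0 < N)%N ->
  let Q := Rpower (INR N) (eps / (2 * INR d)) in
  forall (P : seq nat), uniq P ->
    (forall p, p \in P -> prime p /\ INR p <= Q) ->
    wP P >= kappa * ln Q ->
  forall (S : {set point d N}),
    INR #|S| >= c0 * Rpower (INR N) (INR k - 1 + eps) ->
    (forall p, p \in P -> INR (nclasses p S) <= alpha * INR p ^ k) ->
  exists f : {mpoly int[d]},
    (f != 0)%R /\
    (msize f <= C.+1)%N /\
    (forall m, (absz (f@_m)%R <= expn N C)%N) /\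
    INR #|[set x in S | evalpt f x == 0%R]| > (1 - eta) * INR #|S|.
Proof.
move=> kd eps0 eta0 kappa0 alpha0 c00.
have d0 : (0 < d)%N by apply: leq_ltn_trans kd.
have d0' : 0 < INR d by apply: lt_0_INR; apply/ltP.
pose th := eps / (2 * INR d).
have th0 : 0 < th by apply: Rdiv_lt_0_compat; lra.
(* The factor [th] converts log Q to log N; the cap 1/2 keeps the trimmed weight, at most kap log N
   + 1, within log N when log N >= 2. *)
pose kap := Rmin (kappa * th) (1 / 2).
have kap0 : 0 < kap by apply: Rmin_glb_lt; [apply: Rmult_lt_0_compat|lra].
have kapl : kap <= kappa * th := Rmin_l _ _.
have kapr : kap <= 1 / 2 := Rmin_r _ _.
(* Losing only eta/2 leaves room for the strict inequality of the conclusion. *)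
have [c hc] := @characteristic_set d eps d0 eps0 k kap alpha c0 (eta / 2) kap0 alpha0 c00 ltac:(lra).
(* Since r <= 2d(s+1), this s gives 2 c r^k <= s (s+1)^k <= (s+1)^(k+1) <= (s+1)^d, the last by k <
   d. *)
pose s := (2 * c * (2 * d) ^ k)%N.
(* The exponent in the bound that [siegel] gives for the values of the polynomial. *)
pose r := (2 * (d * s).+1)%N.
have [N1 h1] := hc r isT.
have [N2 h2] := eventually_ln 2.
pose M := maxn (maxn N1 N2) (2 * s.+1 ^ d).
have [C0 hC0] := vanishing_upto M d0.
exists (maxn C0 (d * s).+1) => N N0 Q P uP hP hw S /Rge_le hS hcl.
have S0 : 0 < INR #|S|.
  by apply: Rlt_le_trans hS; apply: Rmult_lt_0_compat => //; exact: exp_pos.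
have es : 0 < eta * INR #|S| by apply: Rmult_lt_0_compat.
case: (ltnP N M) => NM.
  have [f [f0 fs fm fx]] := vanishing_mono N0 (leq_maxl C0 (d * s).+1) (hC0 N N0 NM).
  exists f; split=> //; split=> //; split=> //.
  have -> : [set x in S | evalpt f x == 0%R] = S.
    by apply/setP => x; rewrite inE fx eqxx andbT.
  lra.
move: NM; rewrite !geq_max => /andP[/andP[hN1 hN2] hN3].
have L2 := h2 N hN2.
have lnQ : ln Q = th * ln (INR N) by rewrite /Q /Rpower ln_exp.
have hw1 : kap * ln (INR N) <= W P xpredT.
  rewrite -wP_W; apply: Rle_trans (Rge_le _ _ hw); rewrite lnQ -Rmult_assoc.
  by apply: Rmult_le_compat_r; lra.
have kL0 : 0 <= kap * ln (INR N) by apply: Rmult_le_pos; lra.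
have [P' sP [hP1 hP2]] := trim_weight kL0 hw1.
have kL1 : kap * ln (INR N) <= 1 / 2 * ln (INR N) by apply: Rmult_le_compat_r; lra.
have sP' := mem_subseq sP.
have aP : adm d eps N P'.
  split; [exact: subseq_uniq uP|by move=> p /sP'/hP[]|by move=> p /sP'/hP[]|lra].
have [|A [B [hA hB hSB hf]]] := h1 N hN1 P' aP hP1 S hS.
  by move=> p /sP' pP; rewrite -nclasses_red; apply: hcl.
have cA : (2 * #|A| <= s.+1 ^ d)%N.
  apply: (@leq_trans (s.+1 ^ k.+1)); last exact: leq_pexp2l.
  apply: (@leq_trans (s * s.+1 ^ k)); last by rewrite expnS leq_mul2r leqnSn orbT.
  have rk : (r ^ k <= (2 * d) ^ k * s.+1 ^ k)%N.
    rewrite -expnMn; case: (posnP k) => [->//|k0]; rewrite leq_exp2r // /r mulnS.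
    by nia.
  have := leq_mul (leqnn (2 * c)) rk; rewrite mulnA -/s.
  by apply: leq_trans; rewrite -mulnA leq_mul2l hA.
have [f [f0 fs fm fA fx]] := siegel N0 cA hN3.
exists f; split=> //; split.
  by apply: leq_trans fs _; rewrite ltnS; apply: leq_trans (leq_maxr _ _).
split.
  by move=> m; apply: leq_trans (fm m) _; apply: leq_pexp2l => //; apply: leq_maxr.
have tf : tame r (evalpt f : point d N -> int).
  by split=> // p x y; apply: evalpt_mod.
have Z : INR #|B| <= INR #|[set x in S | evalpt f x == 0%R]|.
  apply: INR_cardm; apply/subsetP => x xB; rewrite inE (subsetP hB _ xB) /=.
  by rewrite (hf _ tf fA x xB).
have cS : INR #|S| = INR #|B| + INR #|S :\: B|.
  by rewrite -plus_INR plusE cardsDS // subnKC // subset_leq_card.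
lra.
Qed.
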